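(* Suppose $n$ is an odd integer with $t_1+t_2\leq n<t_3$, and put $K=k_1+k_2+k_3$, $N=\tfrac{n+1}{2}$. Then: (i) the $\mathfrak{BI}$-module $\mathscr M_n(x_1)\cap\mathscr M_n(x_2)$ is isomorphic to $W_1\oplus W_1$, where $W_1=E_{n-t_1-t_2}(k_2+k_3+N,\,-k_1-k_3-N,\,N)^{((-1,-1),(1\,2))}$; (ii) the $\mathfrak{BI}$-modules $\mathscr M_n(x_2)/(\mathscr M_n(x_1)\cap\mathscr M_n(x_2))$ and $\mathscr M_n/\mathscr M_n(x_1)$ are each isomorphic to $W_2\oplus W_2$, where $W_2=O_{t_1-1}(k_3,\,-K-n-1,\,k_2)^{(1\,2)}$; (iii) the $\mathfrak{BI}$-modules $\mathscr M_n(x_1)/(\mathscr M_n(x_1)\cap\mathscr M_n(x_2))$ and $\mathscr M_n/\mathscr M_n(x_2)$ are each isomorphic to $W_3\oplus W_3$, where $W_3=O_{t_2-1}(k_3,\,-K-n-1,\,k_1)$. Moreover, if $k_3\geq0$, then $W_1,W_2,W_3$ are irreducible, $W_1$ is isomorphic to $E_{n-t_1-t_2}(k_1+k_3+N,\,k_2+k_3+N,\,N)^{(-1,-1)}$ and $W_2$ is isomorphic to $O_{t_1-1}(-K-n-1,\,k_3,\,k_2)$.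
   Context: Fix real numbers $k_1,k_2,k_3$. For $i=1,2,3$ let $R_i$ be the operator on functions on $\mathbb R^3$ replacing $x_i$ by $-x_i$, and $T_if=\frac{\partial f}{\partial x_i}+k_i\frac{f-R_if}{x_i}$ (Dunkl operators). Let $\sigma_1=\begin{pmatrix}0&1\\1&0\end{pmatrix}$, $\sigma_2=\begin{pmatrix}0&-\sqrt{-1}\\ \sqrt{-1}&0\end{pmatrix}$, $\sigma_3=\begin{pmatrix}1&0\\0&-1\end{pmatrix}$, and let $e_i$ act on $\mathbb C^2$ by $\sigma_i$. Tensor products are over $\mathbb R$; $\mathbb R[\cdots]_m$ denotes homogeneous polynomials of degree $m$. Let $\mathbf D=e_1\otimes T_1+e_2\otimes T_2+e_3\otimes T_3$ and $\mathscr M_n=\ker(\mathbf D|_{\mathbb C^2\otimes\mathbb R[x_1,x_2,x_3]_n})$. For $i=1,2,3$ set $t_i=-2k_i$ if $2k_i$ is an odd negative integer, and $t_i=\infty$ otherwise. For $i=1,2,3$, $\mathscr M_n(x_i)=\mathscr M_n\cap\bigoplus_{j=t_i}^n\mathbb C^2\otimes(x_i^j\cdot\mathbb R[x_p,x_q]_{n-j})$ where $\{p,q\}=\{1,2,3\}\setminus\{i\}$ (it is $\{0\}$ if $n<t_i$); it is a $\mathfrak{BI}$-submodule of $\mathscr M_n$. $\mathfrak{BI}$ is the unital associative $\mathbb C$-algebra generated by $X,Y,Z$ with relations saying that $\{X,Y\}-Z$, $\{Y,Z\}-X$, $\{Z,X\}-Y$ commute with $X,Y,Z$ ($\{A,B\}=AB+BA$).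 $\mathscr M_n$ is a $\mathfrak{BI}$-module via $X=(\sqrt{-1}\,e_1\otimes(x_3T_2-x_2T_3)+\tfrac12)R_2R_3+k_2R_3+k_3R_2$, $Y=(\sqrt{-1}\,e_2\otimes(x_1T_3-x_3T_1)+\tfrac12)R_1R_3+k_3R_1+k_1R_3$, $Z=(\sqrt{-1}\,e_3\otimes(x_2T_1-x_1T_2)+\tfrac12)R_1R_2+k_1R_2+k_2R_1$, operators composed right to left, $R_i$ acting on the polynomial factor. Twisting: for a $\mathfrak{BI}$-module $V$ and algebra automorphism $\varepsilon$, $V^\varepsilon$ is $V$ with action $x\cdot v=\varepsilon(x)v$. A permutation $\sigma\in\mathfrak S_3$ denotes the automorphism sending the generator with index $i$ in $(X,Y,Z)$ to the generator with index $\sigma(i)$ (e.g. $(1\,2)$ swaps $X,Y$ and fixes $Z$); the sign automorphisms are $(1,-1)\colon X\mapsto X,Y\mapsto -Y,Z\mapsto -Z$; $(-1,1)\colon X\mapsto -X,Y\mapsto Y,Z\mapsto -Z$; $(-1,-1)\colon X\mapsto -X,Y\mapsto -Y,Z\mapsto Z$; a pair $(\epsilon,\sigma)$ denotes the composite $\epsilon\circ\sigma$. For $a,b,c\in\mathbb C$ and an integer $d\geq0$, let $\theta_i=\frac{(-1)^i(2a-d+2i)}{2}$, $\theta^*_i=\frac{(-1)^i(2b-d+2i)}{2}$ ($0\le i\le d$). For odd $d$, $E_d(a,b,c)$ is the $\mathfrak{BI}$-module $\mathbb C^{d+1}$ in which, w.r.t. a basis $v_0,\dots,v_d$, $X$ acts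 by the lower bidiagonal matrix with diagonal $(\theta_i)$ and subdiagonal entries $1$, $Y$ by the upper bidiagonal matrix with diagonal $(\theta^*_i)$ and superdiagonal $(\varphi_1,\dots,\varphi_d)$ with $\varphi_i=i(d-i+1)$ ($i$ even), $\varphi_i=c^2-\frac{(2a+2b-d+2i-1)^2}{4}$ ($i$ odd), and $Z=\{X,Y\}-\big(c^2-a^2-b^2+\frac{(d+1)^2}{4}\big)$. For even $d$, $O_d(a,b,c)$ is defined in the same way but with $\varphi_i=\frac{i(d+1-2i-2a-2b-2c)}{2}$ ($i$ even), $\varphi_i=\frac{(i-d-1)(d+1-2i-2a-2b+2c)}{2}$ ($i$ odd), and $Z=\{X,Y\}-(2ab-c(d+1))$. *)

(* Defs.v *)
From HB Require Import structures.
From mathcomp Require Import all_boot all_order all_algebra.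
From mathcomp Require Import reals complex mpoly.

Set Implicit Arguments.
Unset Strict Implicit.
Unset Printing Implicit Defensive.

Import Order.TTheory GRing.Theory Num.Theory.
Local Open Scope ring_scope.

Section DunklBI.

Variable R : realType.

Local Notation C := (complex R).

Definition toC (x : R) : C := Complex x 0.
Definition sqrtm1 : C := Complex 0 1.

Definition Pol := {mpoly C[3]}.

Definition i1 : 'I_3 := @Ordinal 3 0 isT.
Definition i2 : 'I_3 := @Ordinal 3 1 isT.
Definition i3 : 'I_3 := @Ordinal 3 2 isT.

Definition refl (i : 'I_3) (p : Pol) : Pol :=
  p \mPo [tuple (if j == i then - 'X_j else 'X_j : Pol) | j < 3].

(* division by x_i: for p divisible by x_i this is the exact quotient p / x_i
   (monomials not divisible by x_i are discarded; it is only applied to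
   p - R_i p, which is divisible by x_i). *)
Definition divx (i : 'I_3) (p : Pol) : Pol :=
  \sum_(m <- msupp p | (0 < m i)%N) (p@_m *: 'X_[m - U_(i)]%MM).

Definition dunkl (k : 'I_3 -> R) (i : 'I_3) (p : Pol) : Pol :=
  mderiv i p + toC (k i) *: divx i (p - refl i p).

(* C^2 (x)_R R[x1,x2,x3] = C[x]^2 ; an element is a pair (f_1, f_2) *)
Definition Sp := (Pol * Pol)%type.

Definition onpol (f : Pol -> Pol) (u : Sp) : Sp := (f u.1, f u.2).

(* e_i acting on C^2 by the Pauli matrices sigma_i *)
Definition e1 (u : Sp) : Sp := (u.2, u.1).
Definition e2 (u : Sp) : Sp := (- (sqrtm1 *: u.2), sqrtm1 *: u.1).
Definition e3 (u : Sp) : Sp := (u.1, - u.2).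

Definition kfun (k1 k2 k3 : R) (i : 'I_3) : R :=
  if i == i1 then k1 else if i == i2 then k2 else k3.

Definition Dop (k1 k2 k3 : R) (u : Sp) : Sp :=
  let T := dunkl (kfun k1 k2 k3) in
  e1 (onpol (T i1) u) + e2 (onpol (T i2) u) + e3 (onpol (T i3) u).

Definition Mn (k1 k2 k3 : R) (n : nat) (u : Sp) : Prop :=
  u.1 \is n.-homog /\ u.2 \is n.-homog /\ Dop k1 k2 k3 u = 0.

(* t_i as an element of nat + {infinity} (None = infinity):
   tspec k t  <->  t = -2k if 2k is an odd negative integer, t = None otherwise *)
Definition tspec (k : R) (t : option nat) : Prop :=
  forall m : nat, t = Some m <-> (odd m /\ 2 * k = - (m%:R)).

(* "p lies in (+)_{j = t}^{n} x_i^j R[x_p, x_q]_{n-j}" (given p homogeneous of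
   degree n): every monomial of p has x_i-degree >= t ; for t = infinity: p = 0 *)
Definition xdeg_ge (i : 'I_3) (t : option nat) (p : Pol) : Prop :=
  match t with
  | None => p = 0
  | Some t => forall m, m \in msupp p -> (t <= m i)%N
  end.

Definition Mnx (k1 k2 k3 : R) (n : nat) (i : 'I_3) (t : option nat) (u : Sp)
  : Prop := Mn k1 k2 k3 n u /\ xdeg_ge i t u.1 /\ xdeg_ge i t u.2.

Definition BIgen (k : 'I_3 -> R) (e : Sp -> Sp) (p q : 'I_3) (u : Sp) : Sp :=
  let v := onpol (refl p) (onpol (refl q) u) in
  sqrtm1 *: e (onpol (fun f => 'X_q * dunkl k p f - 'X_p * dunkl k q f) v)
  + (1 / 2 : C) *: v
  + toC (k p) *: onpol (refl q) u + toC (k q) *: onpol (refl p) u.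

Definition Xop (k1 k2 k3 : R) := BIgen (kfun k1 k2 k3) e1 i2 i3.
Definition Yop (k1 k2 k3 : R) := BIgen (kfun k1 k2 k3) e2 i3 i1.
Definition Zop (k1 k2 k3 : R) := BIgen (kfun k1 k2 k3) e3 i1 i2.

(* a finite dimensional BI-module structure on C^m (column vectors):
   the matrices by which X, Y, Z act *)
Record BImod (m : nat) := mkBI { bX : 'M[C]_m; bY : 'M[C]_m; bZ : 'M[C]_m }.

Definition tw12 m (W : BImod m) : BImod m := mkBI (bY W) (bX W) (bZ W).
Definition twmm m (W : BImod m) : BImod m := mkBI (- bX W) (- bY W) (bZ W).
(* W^((-1,-1),(1 2)) = W^(eps o sigma), on which x acts by eps(sigma(x))
   = (W^(-1,-1))^(1 2) *)
Definition twmm12 m (W : BImod m) : BImod m := tw12 (twmm W).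

Definition theta (a : C) (d i : nat) : C :=
  (-1) ^+ i * (2 * a - d%:R + 2 * i%:R) / 2.

Definition Xmat (a : C) (d : nat) : 'M[C]_d.+1 :=
  \matrix_(i, j) (if i == j then theta a d i
                  else if (i : nat) == j.+1 then 1 else 0).

Definition Ymat (b : C) (d : nat) (phi : nat -> C) : 'M[C]_d.+1 :=
  \matrix_(i, j) (if i == j then theta b d i
                  else if (j : nat) == i.+1 then phi (j : nat) else 0).

(* E_d(a,b,c) (d odd) *)
Definition phiE (a b c : C) (d i : nat) : C :=
  if ~~ odd i then i%:R * (d%:R - i%:R + 1)
  else c ^+ 2 - (2 * a + 2 * b - d%:R + 2 * i%:R - 1) ^+ 2 / 4.

Definition Emod (d : nat) (a b c : C) : BImod d.+1 :=
  let X := Xmat a d in let Y := Ymat b d (phiE a b c d) in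
  mkBI X Y (X *m Y + Y *m X
            - (c ^+ 2 - a ^+ 2 - b ^+ 2 + (d%:R + 1) ^+ 2 / 4)%:M).

(* O_d(a,b,c) (d even) *)
Definition phiO (a b c : C) (d i : nat) : C :=
  if ~~ odd i then i%:R * (d%:R + 1 - 2 * i%:R - 2 * a - 2 * b - 2 * c) / 2
  else (i%:R - d%:R - 1) * (d%:R + 1 - 2 * i%:R - 2 * a - 2 * b + 2 * c) / 2.

Definition Omod (d : nat) (a b c : C) : BImod d.+1 :=
  let X := Xmat a d in let Y := Ymat b d (phiO a b c d) in
  mkBI X Y (X *m Y + Y *m X - (2 * a * b - c * (d%:R + 1))%:M).

(* W is irreducible: nonzero, and the only subspaces stable under X, Y, Z are
   0 and the whole space (subspaces = row spaces of U; v |-> M v on column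
   vectors corresponds to row vectors v^T |-> v^T M^T) *)
Definition BIirred m (W : BImod m) : Prop :=
  (0 < m)%N /\
  forall U : 'M[C]_m,
    (U *m (bX W)^T <= U)%MS -> (U *m (bY W)^T <= U)%MS ->
    (U *m (bZ W)^T <= U)%MS -> (U == (0 : 'M[C]_m))%MS || row_full U.

Definition BIiso m (W1 W2 : BImod m) : Prop :=
  exists P : 'M[C]_m, P \in unitmx /\
    P *m bX W1 = bX W2 *m P /\ P *m bY W1 = bY W2 *m P /\
    P *m bZ W1 = bZ W2 *m P.

(* For subsets B <= A of C^2 (x) R[x] stable under the operators X, Y, Z
   (given as functions on Sp): the BI-module A / B is isomorphic to W (+) W,
   i.e. there is a C-linear map A -> W (+) W, surjective, intertwining the
   actions of X, Y, Z, with kernel exactly B (first isomorphism theorem). *)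
Definition quot_iso_dbl (XA YA ZA : Sp -> Sp) (A B : Sp -> Prop)
  m (W : BImod m) : Prop :=
  exists f : Sp -> 'cV[C]_m * 'cV[C]_m,
    (forall (c : C) u v, A u -> A v -> f (c *: u + v) = c *: f u + f v) /\
    (forall w, exists2 u, A u & f u = w) /\
    (forall u, A u -> (f u = 0 <-> B u)) /\
    (forall u, A u -> f (XA u) = (bX W *m (f u).1, bX W *m (f u).2)) /\
    (forall u, A u -> f (YA u) = (bY W *m (f u).1, bY W *m (f u).2)) /\
    (forall u, A u -> f (ZA u) = (bZ W *m (f u).1, bZ W *m (f u).2)).

Definition opt_lt (n : nat) (t : option nat) : Prop :=
  match t with None => True | Some t => (n < t)%N end.

End DunklBI.

(* Main.v *)
(* A solution u of D u = 0 is determined by its restriction to x_3 = 0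
   (Cauchy-Kovalevskaya extension), because T_3 x_3^j is a nonzero multiple of
   x_3^(j-1) for 0 < j <= n < t_3.  After restriction, X, Y, Z preserve each of the
   two components of C^2, and on the monomials x_1^(n-j) x_2^j the operator X is
   lower bidiagonal and Y upper bidiagonal.  M_n(x_1) and M_n(x_2) become the spans
   of the monomials with n - j >= t_1 and with j >= t_2, so that every subquotient
   in the statement is carried by an interval of exponents j; rescaling the
   monomials there yields the matrices of E_d and O_d.

   Irreducibility and the remaining isomorphisms come from a second basis of a
   module with X v_i = th_i v_i + v_(i+1): the vectors u_i = (X - th_d)...(X -
   th_(d-i+1)) v_0.  The relation X^2 Y + 2 X Y X + Y X^2 = 2 kap X + Y + mu shows
   by induction that Y is again upper bidiagonal on them, with new superdiagonal
   entries phi'_i.  If no phi_i and no phi'_i vanishes, a nonzero submodule contains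
   a vector with nonzero u_0-coordinate, hence its image v_d under
   (X - th_0)...(X - th_(d-1)), hence everything. *)
Require Import Defs.
From HB Require Import structures.
From mathcomp Require Import all_boot all_order all_algebra.
From mathcomp Require Import reals complex mpoly.
From mathcomp Require Import ring zify.

Set Implicit Arguments.
Unset Strict Implicit.
Unset Printing Implicit Defensive.

Import Order.TTheory GRing.Theory Num.Theory.
Local Open Scope ring_scope.

(** * Coefficients of the Dunkl operators and of X, Y, Z *)

(* [br k j] is the scalar by which T_i lowers x_i^j, for k = k_i.  It is locked
   to keep unification away from the arithmetic of complex numbers. *)
HB.lock Definition br (R : realType) (k : complex R) (j : nat) : complex R :=
  j%:R + k * (1 - (-1) ^+ j).

Lemma brE (R : realType) (k : complex R) j : br k j = j%:R + k * (1 - (-1) ^+ j).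
Proof. by rewrite br.unlock. Qed.

Section DunklCoefficients.
Variable R : realType.
Local Notation C := (complex R).
Implicit Types (p q : Pol R) (m : 'X_{1..3}) (i j : 'I_3).

Lemma mcoeff_refl i p m : (refl i p)@_m = (-1) ^+ m i * p@_m.
Proof.
rewrite /refl comp_mpolyEX raddf_sum /=.
rewrite [in RHS](mpolyE p) raddf_sum mulr_sumr /=.
apply: eq_bigr => k _.
rewrite comp_mpolyX.
have -> : \prod_(j < 3) tnth [tuple (if j == i then - 'X_j else 'X_j : Pol R) | j < 3] j ^+ k j
   = ((-1) ^+ k i : C) *: 'X_[k].
  rewrite (eq_bigr (fun j => ((if j == i then (-1) ^+ k i else 1 : C))%:MP * 'X_j ^+ k j)).
    rewrite big_split /= -rmorph_prod -mpolyXE_id mul_mpolyC; congr (_ *: _).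
    by rewrite (bigD1 i) //= eqxx big1 ?mulr1 // => j /negbTE ->.
  move=> j _; rewrite tnth_mktuple; case: eqP => [->|_]; last by rewrite /= mul1r.
  by rewrite /= rmorphXn /= rmorphN1 -exprNn.
rewrite !mcoeffZ mcoeffX; case: eqP => [->|_]; last by rewrite !mulr0.
by rewrite !mulr1 mulrC.
Qed.

Lemma mcoeff_divx i p m : (divx i p)@_m = p@_(m + U_(i)).
Proof.
rewrite /divx raddf_sum /= (eq_bigr (fun k => (k == m + U_(i))%:R * p@_k)%MM).
  have [hm|hm] := boolP ((m + U_(i))%MM \in msupp p).
    rewrite (big_rem _ hm) /= mnmDE mnm1E eqxx addn1 /= eqxx mul1r.
    rewrite big_seq_cond big1 ?addr0 // => k /andP[].
    rewrite mem_rem_uniq ?msupp_uniq // inE => /andP[/negbTE -> _] _.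
    by rewrite mul0r.
  rewrite (memN_msupp_eq0 hm) big_seq_cond big1 // => k /andP[hk _].
  case: eqP hk hm => [-> -> //|]; by rewrite mul0r.
move=> k hk; rewrite mcoeffZ mcoeffX mulrC; congr ((nat_of_bool _)%:R * _).
(* Truncated subtraction of U_(i) is undone by addition only for k_i > 0, which the range of the sum
   in [divx] guarantees. *)
have hk' : (U_(i) <= k)%MM.
  by apply/mnm_lepP => j; rewrite mnm1E; case: eqP => // <-.
by apply/idP/idP => /eqP; [move=> <-; rewrite submK | move=> ->; rewrite addmK].
Qed.

(** R_i only changes signs of monomials, so at the exponent m_i + 1 the derivative contributes m_i +
    1 and the difference quotient k_i (1 - (-1)^(m_i+1)). *)
Lemma mcoeff_dunkl (k : 'I_3 -> R) i p m :
  (dunkl k i p)@_m = br (toC (k i)) (m i).+1 * p@_(m + U_(i)).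
Proof.
rewrite /dunkl mcoeffD mcoeff_mderiv mcoeffZ mcoeff_divx mcoeffB mcoeff_refl.
by rewrite mnmDE mnm1E eqxx addn1 brE -mulr_natr; ring.
Qed.

Lemma mcoeff_mulX i p m :
  ('X_i * p)@_m = if (0 < m i)%N then p@_(m - U_(i)) else 0.
Proof.
case: ifP => hm.
  have hk : (U_(i) <= m)%MM.
    by apply/mnm_lepP => j; rewrite mnm1E; case: eqP => // <-.
  by rewrite mulrC -{1}(submK hk) addmC mcoeffMX.
rewrite {1}(mpolyE p) mulr_sumr raddf_sum /= big1 // => k _.
rewrite -scalerAr mcoeffZ -mpolyXD mcoeffX.
case: eqP => [e|]; last by rewrite mulr0.
by move: hm; rewrite -e mnmDE mnm1E eqxx add1n.
Qed.

End DunklCoefficients.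

Definition mon (a b c : nat) : 'X_{1..3} := [multinom [tuple a; b; c]].

Lemma monE a b c : (mon a b c i1 = a) * (mon a b c i2 = b) * (mon a b c i3 = c).
Proof. by rewrite /mon !multinomE !(tnth_nth 0%N). Qed.

Lemma ord3P (P : 'I_3 -> Prop) : P i1 -> P i2 -> P i3 -> forall i, P i.
Proof.
move=> h1 h2 h3 [[|[|[|//]]] hi].
- by rewrite (_ : Ordinal hi = i1) //; apply: val_inj.
- by rewrite (_ : Ordinal hi = i2) //; apply: val_inj.
- by rewrite (_ : Ordinal hi = i3) //; apply: val_inj.
Qed.

Lemma mon_eta (m : 'X_{1..3}) : m = mon (m i1) (m i2) (m i3).
Proof. by apply/mnmP; apply: ord3P; rewrite monE. Qed.

Lemma mdeg_mon a b c : mdeg (mon a b c) = (a + b + c)%N.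
Proof. by rewrite mdegE !big_ord_recr big_ord0 /= add0n /mon !multinomE !(tnth_nth 0%N). Qed.

Lemma monD a b c :
  ((mon a b c + U_(i1))%MM = mon a.+1 b c) *
  ((mon a b c + U_(i2))%MM = mon a b.+1 c) *
  ((mon a b c + U_(i3))%MM = mon a b c.+1).
Proof.
by do !split; apply/mnmP; apply: ord3P; rewrite mnmDE mnm1E !monE /= ?addn0 ?addn1.
Qed.

Lemma monB a b c :
  ((mon a.+1 b c - U_(i1))%MM = mon a b c) *
  ((mon a b.+1 c - U_(i2))%MM = mon a b c) *
  ((mon a b c.+1 - U_(i3))%MM = mon a b c).
Proof.
by do !split; apply/mnmP; apply: ord3P; rewrite mnmBE mnm1E !monE /= ?subn0 ?subn1.
Qed.

(** A boolean selects the component of C^2, so that [~~ s] expresses the swap made by e_1 and e_2.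
    Locked, like [br], to keep coefficients opaque. *)
HB.lock Definition cf (R : realType) (s : bool) (u : Sp R) (a b c : nat) : complex R :=
  (if s then u.1 else u.2)@_(mon a b c).

Lemma cfE (R : realType) (s : bool) (u : Sp R) a b c :
  cf s u a b c = (if s then u.1 else u.2)@_(mon a b c).
Proof. by rewrite cf.unlock. Qed.

Section Spinors.
Variable R : realType.
Local Notation C := (complex R).
Local Notation I := (sqrtm1 R).
Variables k1 k2 k3 : R.
Local Notation q1 := (toC k1).
Local Notation q2 := (toC k2).
Local Notation q3 := (toC k3).
Local Notation k := (kfun k1 k2 k3).
Implicit Types (u : Sp R) (s : bool).

Lemma sqrtm1_sqr : I * I = -1 :> C.
Proof. by apply/eqP; rewrite eq_complex /=; apply/andP; split; apply/eqP; ring. Qed.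

Lemma sqrtm1_neq0 : I != 0 :> C.
Proof.
apply/eqP => e; have := sqrtm1_sqr; rewrite e mul0r => /eqP.
by rewrite eq_sym oppr_eq0 oner_eq0.
Qed.

Lemma signM (j : nat) : (-1) ^+ j * (-1) ^+ j = 1 :> C.
Proof. by rewrite -expr2 sqrr_sign. Qed.

(* The eigenvalue of e_3 on the component of C^2 selected by [s]. *)
Definition sg s : C := if s then 1 else -1.

Lemma kfunE : (k i1 = k1) * (k i2 = k2) * (k i3 = k3).
Proof. by []. Qed.

Definition monS := (monE, monD, kfunE).

(** The two components of D u = 0 at x_1^a x_2^b x_3^c, solved for the T_3 term. In this form the
    equation is a recursion in the exponent of x_3. *)
Definition monogenic u := forall s a b c,
  br q3 c.+1 * cf s u a b c.+1 =
  - sg s * br q1 a.+1 * cf (~~ s) u a.+1 b c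
  + I * br q2 b.+1 * cf (~~ s) u a b.+1 c.

Lemma mcoeff_dunkl_mon i a b c (p : Pol R) :
  (dunkl k i p)@_(mon a b c) = br (toC (k i)) (mon a b c i).+1 * p@_(mon a b c + U_(i)).
Proof. exact: mcoeff_dunkl. Qed.

Lemma mcoeff_Dop1 u a b c : (Dop k1 k2 k3 u).1@_(mon a b c) =
   br q1 a.+1 * cf false u a.+1 b c - I * (br q2 b.+1 * cf false u a b.+1 c)
   + br q3 c.+1 * cf true u a b c.+1.
Proof.
(* Abstracting the Dunkl operators leaves only their coefficient formula and prevents their
   unfolding. *)
rewrite !cfE /Dop /=; move: (dunkl k) mcoeff_dunkl_mon => D hd.
by rewrite mcoeffD mcoeffD mcoeffN mcoeffZ !hd !monS.
Qed.

Lemma mcoeff_Dop2 u a b c : (Dop k1 k2 k3 u).2@_(mon a b c) =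
   br q1 a.+1 * cf true u a.+1 b c + I * (br q2 b.+1 * cf true u a b.+1 c)
   - br q3 c.+1 * cf false u a b c.+1.
Proof.
rewrite !cfE /Dop /=; move: (dunkl k) mcoeff_dunkl_mon => D hd.
by rewrite mcoeffD mcoeffD mcoeffN mcoeffZ !hd !monS.
Qed.

Lemma Dop0P u : Dop k1 k2 k3 u = 0 <-> monogenic u.
Proof.
split=> [e [] a b c|hu].
- have := mcoeff_Dop1 u a b c; rewrite e mcoeff0 /sg /= => /esym/eqP.
  by rewrite addrC addr_eq0 => /eqP ->; ring.
- have := mcoeff_Dop2 u a b c; rewrite e mcoeff0 /sg /= => /esym/eqP.
  by rewrite subr_eq0 => /eqP <-; ring.
- have h (v : Sp R) : v.1 = 0 -> v.2 = 0 -> v = 0 by case: v => ? ? /= -> ->.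
  apply: h; apply/mpolyP => m; rewrite (mon_eta m) mcoeff0.
  + by rewrite mcoeff_Dop1 (hu true) /sg /=; ring.
  + by rewrite mcoeff_Dop2 (hu false) /sg /=; ring.
Qed.

Lemma cf_BIgen (e : Sp R -> Sp R) p q s u a b c :
  let v := onpol (refl p) (onpol (refl q) u) in
  let w := onpol (fun f => 'X_q * dunkl k p f - 'X_p * dunkl k q f) v in
  cf s (BIgen k e p q u) a b c =
  I * cf s (e w) a b c + 1 / 2 * ((-1) ^+ mon a b c p * ((-1) ^+ mon a b c q * cf s u a b c))
  + toC (k p) * ((-1) ^+ mon a b c q * cf s u a b c)
  + toC (k q) * ((-1) ^+ mon a b c p * cf s u a b c).
Proof.
move=> v w.
have hr (f : Sp R) i : cf s (onpol (refl i) f) a b c = (-1) ^+ mon a b c i * cf s f a b c.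
  by rewrite !cfE; case: (s); rewrite /= mcoeff_refl.
have hl x y z (f1 f2 f3 f4 : Sp R) : cf s (I *: f1 + x *: f2 + y *: f3 + z *: f4) a b c
    = I * cf s f1 a b c + x * cf s f2 a b c + y * cf s f3 a b c + z * cf s f4 a b c.
  by rewrite !cfE; case: (s); rewrite /= 3!mcoeffD 4!mcoeffZ.
rewrite -(hr u q) -(hr u p) -(hr (onpol (refl q) u) p).
exact: hl.
Qed.

Lemma mcoeff_mulX_dunkl p q i j s u a b c :
  let v := onpol (refl p) (onpol (refl q) u) in
  let m' := (mon a b c - U_(i))%MM in
  (if s then ('X_i * dunkl k j v.1) else ('X_i * dunkl k j v.2))@_(mon a b c) =
  if (0 < mon a b c i)%N then
    br (toC (k j)) (m' j).+1 *
    ((-1) ^+ (m' + U_(j))%MM p * ((-1) ^+ (m' + U_(j))%MM q *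
      (if s then u.1 else u.2)@_(m' + U_(j))))
  else 0.
Proof.
by move=> v m'; case: s; rewrite mcoeff_mulX mcoeff_dunkl !mcoeff_refl.
Qed.

(** At x_3 = 0 only -x_2 T_3 survives in the bracket. It reads a coefficient of x_3^1 in the other
    component, which D u = 0 turns back into coefficients at x_3 = 0 of component s; one of these
    adds to the diagonal. *)
Lemma cf_Xop s u a b : monogenic u ->
  cf s (Xop k1 k2 k3 u) a b 0 =
  (-1) ^+ b * (q2 + q3 + b%:R + 1 / 2) * cf s u a b 0
  + (if (0 < b)%N then - I * sg s * (-1) ^+ b * br q1 a.+1 * cf s u a.+1 b.-1 0 else 0).
Proof.
move=> hu; rewrite cf_BIgen !monS.
have -> : cf s (e1 (onpol (fun f => 'X_i3 * dunkl k i2 f - 'X_i2 * dunkl k i3 f)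
     (onpol (refl i2) (onpol (refl i3) u)))) a b 0 =
   - (if (0 < b)%N then (-1) ^+ b * (br q3 1 * cf (~~ s) u a b.-1 1) else 0).
  have h := @mcoeff_mulX_dunkl i2 i3 _ _ (~~ s) u a b 0.
  have := h i3 i2; have := h i2 i3; move: (dunkl k) h => D _.
  rewrite !cfE !monS; case: s => /= h1 h2; rewrite mcoeffB h1 h2 /= sub0r;
    congr (- _); case: b {h1 h2} => //= b; rewrite monB !monS !exprS; ring.
rewrite hu negbK; case: b => [|b] /=; rewrite ?brE /sg ?exprS; first by ring.
have I2 := sqrtm1_sqr.
have X2 := signM b.
by case: s => /=; ring: I2 X2.
Qed.

Lemma cf_Yop s u a b : monogenic u ->
  cf s (Yop k1 k2 k3 u) a b 0 =
  (-1) ^+ a * (q1 + q3 + a%:R + 1 / 2) * cf s u a b 0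
  + (if (0 < a)%N then I * sg s * (-1) ^+ a * br q2 b.+1 * cf s u a.-1 b.+1 0 else 0).
Proof.
move=> hu; rewrite cf_BIgen !monS.
have -> : I * cf s (e2 (onpol (fun f => 'X_i1 * dunkl k i3 f - 'X_i3 * dunkl k i1 f)
     (onpol (refl i3) (onpol (refl i1) u)))) a b 0 =
   sg s * (if (0 < a)%N then (-1) ^+ a * (br q3 1 * cf (~~ s) u a.-1 b 1) else 0).
  have I2 := sqrtm1_sqr.
  have h := @mcoeff_mulX_dunkl i3 i1 _ _ (~~ s) u a b 0.
  have := h i3 i1; have := h i1 i3; move: (dunkl k) h => D _.
  rewrite !cfE !monS /sg; case: s => /= h1 h2;
    rewrite ?mcoeffN mcoeffZ mcoeffB h1 h2 /= subr0;
    case: a {h1 h2} => [|a] /=; rewrite ?monB ?monS ?exprS; ring: I2.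
rewrite hu negbK; case: a => [|a] /=; rewrite ?brE /sg ?exprS; first by ring.
have X2 := signM a.
by case: s => /=; ring: X2.
Qed.

(** The bracket x_2 T_1 - x_1 T_2 leaves the exponent of x_3 alone and e_3 is diagonal, so Z acts
    directly on the restriction to x_3 = 0. *)
Lemma cf_Zop s u a b :
  cf s (Zop k1 k2 k3 u) a b 0 =
  ((-1) ^+ (a + b) / 2 + q1 * (-1) ^+ b + q2 * (-1) ^+ a) * cf s u a b 0
  + (if (0 < b)%N then I * sg s * (-1) ^+ (a + b) * br q1 a.+1 * cf s u a.+1 b.-1 0 else 0)
  - (if (0 < a)%N then I * sg s * (-1) ^+ (a + b) * br q2 b.+1 * cf s u a.-1 b.+1 0 else 0).
Proof.
rewrite cf_BIgen !monS.
have h := @mcoeff_mulX_dunkl i1 i2 _ _ s u a b 0.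
have := h i2 i1; have := h i1 i2; move: (dunkl k) h => D _.
rewrite exprD !cfE !monS /sg; case: s => /= h1 h2;
  rewrite ?mcoeffN mcoeffB h1 h2 /=; case: a {h1 h2} => [|a] /=; case: b => [|b] /=;
  rewrite ?monB ?monS ?monB ?monS ?exprS; ring.
Qed.

End Spinors.

(** * Restriction to x_3 = 0 *)

Section CauchyKovalevskaya.
Variable R : realType.
Local Notation C := (complex R).
Local Notation I := (sqrtm1 R).
Variables k1 k2 k3 : R.
Local Notation q1 := (toC k1).
Local Notation q2 := (toC k2).
Local Notation q3 := (toC k3).
Variable n : nat.
Hypothesis br3 : forall c, (0 < c <= n)%N -> br q3 c != 0.
Implicit Types (u : Sp R) (s : bool).
Local Notation M := (Mn k1 k2 k3 n).

Lemma homog_of_mcoeff (E : 'X_{1..3} -> C) :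
  exists2 p : Pol R, p \is n.-homog & forall m, mdeg m = n -> p@_m = E m.
Proof.
pose E' (m : 'X_{1..3}) := if mdeg m == n then E m else 0.
pose p : Pol R := \sum_(m : 'X_{1..3 < n.+1}) E' m *: 'X_[m].
have hp m : (mdeg m < n.+1)%N -> p@_m = E' m by apply: mcoeff_mpoly.
exists p => [|m hm]; last by rewrite hp ?hm // /E' hm eqxx.
apply/dhomogP => m; rewrite mcoeff_msupp; have [hm|hm] := ltnP (mdeg m) n.+1.
  by rewrite hp // /E'; have [e _|_] := eqVneq (mdeg m) n; [exact: e | rewrite eqxx].
rewrite raddf_sum big1 ?eqxx //= => -[m' hm'] _ /=.
rewrite mcoeffZ mcoeffX; case: eqP => [e|]; last by rewrite mulr0.
by move: hm'; rewrite e ltnNge hm.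
Qed.

Lemma homog_mcoeff0 (p : Pol R) a b c :
  p \is n.-homog -> (a + b + c != n)%N -> p@_(mon a b c) = 0.
Proof.
move=> /dhomogP hp hn; apply: memN_msupp_eq0; apply/negP => /hp e.
by have {}e : mdeg (mon a b c) = n := e; rewrite mdeg_mon in e; rewrite e eqxx in hn.
Qed.

Lemma cf_homog s u a b c : M u -> (a + b + c != n)%N -> cf s u a b c = 0.
Proof.
move=> [h1 [h2 _]] hn; rewrite cfE.
by case: (s); apply: homog_mcoeff0.
Qed.

Lemma Mn_monogenic u : M u -> monogenic k1 k2 k3 u.
Proof. by move=> [_ [_ /Dop0P]]. Qed.

(** Solves the recursion of [monogenic] upward in c. The initial data depend on b alone because
    homogeneity fixes a = n - b. *)
Fixpoint ck_coeff (f : bool -> nat -> C) (c : nat) s a b : C :=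
  if c is c'.+1 then
    (br q3 c)^-1 * (- sg R s * br q1 a.+1 * ck_coeff f c' (~~ s) a.+1 b
                    + I * br q2 b.+1 * ck_coeff f c' (~~ s) a b.+1)
  else f s b.

Lemma ck_extension (f : bool -> nat -> C) :
  exists2 u, M u & forall s j, (j <= n)%N -> cf s u (n - j) j 0 = f s j.
Proof.
pose E s (m : 'X_{1..3}) := ck_coeff f (m i3) s (m i1) (m i2).
have [p1 hom1 hp1] := homog_of_mcoeff (E true).
have [p2 hom2 hp2] := homog_of_mcoeff (E false).
pose u : Sp R := (p1, p2).
have hE s a b c : (a + b + c)%N = n -> cf s u a b c = ck_coeff f c s a b.
  by rewrite cfE => e; case: s; rewrite ?hp1 ?hp2 ?mdeg_mon // /E !monE.
have h0 s a b c : (a + b + c != n)%N -> cf s u a b c = 0.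
  by move=> hn; rewrite cfE; case: (s); apply: homog_mcoeff0.
exists u => [|s j hj]; last by rewrite hE // addn0 subnK.
split=> //; split=> //; apply/Dop0P => s a b c.
(* In total degree n the recursion applies, with c + 1 in the range where [br q3] is invertible; in
   any other degree all terms are zero. *)
have [e|hn] := eqVneq (a + b + c.+1)%N n.
  rewrite !hE ?addSn -?addnS ?addSn //=; last by rewrite -e; lia.
  rewrite mulrA divff ?mul1r //; apply: br3; lia.
rewrite !h0 ?mulr0 ?addr0 //; first [done | apply: contra hn => /eqP <-; apply/eqP; lia].
Qed.

(** Vanishing at x_3 = 0 on a region P of exponents (a, b) propagates to all c by the recursion,
    provided each step out of P carries a zero bracket. *)
Lemma ck_vanish (P : nat -> nat -> bool) u : M u ->
  (forall a b, P a b -> P a.+1 b \/ br q1 a.+1 = 0) ->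
  (forall a b, P a b -> P a b.+1 \/ br q2 b.+1 = 0) ->
  (forall s j, (j <= n)%N -> P (n - j)%N j -> cf s u (n - j) j 0 = 0) ->
  forall s a b c, P a b -> cf s u a b c = 0.
Proof.
move=> hM h1 h2 h0 s a b c; elim: c s a b => [|c IH] s a b hP.
  have [e|hn] := eqVneq (a + b + 0)%N n; last exact: cf_homog.
  by have := h0 s b; rewrite (_ : n - b = a)%N; [apply => //; lia | lia].
have [e|hn] := eqVneq (a + b + c.+1)%N n; last exact: cf_homog.
have b3 : br q3 c.+1 != 0 by apply: br3; lia.
apply: (mulfI b3); rewrite (Mn_monogenic hM) mulr0.
have -> : br q1 a.+1 * cf (~~ s) u a.+1 b c = 0 -> br q2 b.+1 * cf (~~ s) u a b.+1 c = 0 ->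
   - sg R s * br q1 a.+1 * cf (~~ s) u a.+1 b c + I * br q2 b.+1 * cf (~~ s) u a b.+1 c = 0 => //.
- by move=> e1 e2; rewrite -!mulrA e1 e2 !mulr0 addr0.
- by have [/IH ->|->] := h1 _ _ hP; rewrite ?mulr0 ?mul0r.
- by have [/IH ->|->] := h2 _ _ hP; rewrite ?mulr0 ?mul0r.
Qed.

Lemma xdeg_geP i t u :
  xdeg_ge i (Some t) u.1 /\ xdeg_ge i (Some t) u.2 <->
  forall s a b c, (mon a b c i < t)%N -> cf s u a b c = 0.
Proof.
split=> [[h1 h2] s a b c hm|h].
  rewrite cfE; apply: memN_msupp_eq0; apply/negP; move: hm; rewrite ltnNge => /negP hm.
  by case: (s) => [/h1|/h2].
split=> m; rewrite mcoeff_msupp leqNgt; apply: contra => hm.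
  by have := h true (m i1) (m i2) (m i3); rewrite cfE -mon_eta => ->.
by have := h false (m i1) (m i2) (m i3); rewrite cfE -mon_eta => ->.
Qed.

(** The region a < t is closed for [ck_vanish]: the only step leaving it ends at a + 1 = t and
    carries the factor [br q1 t] = 0. *)
Lemma Mnx1P t u : br q1 t = 0 ->
  Mnx k1 k2 k3 n i1 (Some t) u <->
  M u /\ forall s j, (j <= n)%N -> (n - j < t)%N -> cf s u (n - j) j 0 = 0.
Proof.
move=> bt; split=> -[hM].
  by move=> /xdeg_geP h; split=> // s j _ hj; apply: h; rewrite monE.
move=> h; split=> //; apply/xdeg_geP => s a b c; rewrite monE.
move=> ha; apply: (@ck_vanish (fun a b => a < t)%N) => //= a' b' ha'; last by left.
by move: ha'; rewrite leq_eqVlt => /orP[/eqP ->|]; [right|left].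
Qed.

Lemma Mnx2P t u : br q2 t = 0 ->
  Mnx k1 k2 k3 n i2 (Some t) u <->
  M u /\ forall s j, (j <= n)%N -> (j < t)%N -> cf s u (n - j) j 0 = 0.
Proof.
move=> bt; split=> -[hM].
  by move=> /xdeg_geP h; split=> // s j _ hj; apply: h; rewrite monE.
move=> h; split=> //; apply/xdeg_geP => s a b c; rewrite monE.
move=> ha; apply: (@ck_vanish (fun a b => b < t)%N) => //= a' b' ha'; first by left.
by move: ha'; rewrite leq_eqVlt => /orP[/eqP ->|]; [right|left].
Qed.

Lemma Mn_eq0P u : M u ->
  (u = 0 <-> forall s j, (j <= n)%N -> cf s u (n - j) j 0 = 0).
Proof.
move=> hM; split=> [-> s j _|h]; first by rewrite cfE; case: (s); rewrite mcoeff0.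
have hu s a b c : cf s u a b c = 0.
  by apply: (@ck_vanish (fun _ _ => true)) => //= *; [left|left|apply: h].
have e (v : Sp R) : v.1 = 0 -> v.2 = 0 -> v = 0 by case: v => ? ? /= -> ->.
apply: e; apply/mpolyP => m; rewrite (mon_eta m) mcoeff0.
  by have := hu true (m i1) (m i2) (m i3); rewrite cfE.
by have := hu false (m i1) (m i2) (m i3); rewrite cfE.
Qed.

(* [w] enumerates the exponents j of the monomials x_1^(n-j) x_2^j that survive
   in A / B: the coordinates in [PA] vanish on A, those in [PB] vanish on B. *)
Lemma quot_window (X Y Z : Sp R -> Sp R) (A B : Sp R -> Prop) (PA PB : pred nat) d
    (w : nat -> nat) (c : bool -> nat -> C) (W : BImod R d.+1) :
  (forall u, A u <-> M u /\ forall s j, (j <= n)%N -> PA j -> cf s u (n - j) j 0 = 0) ->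
  (forall u, A u -> (B u <-> forall s j, (j <= n)%N -> PB j -> cf s u (n - j) j 0 = 0)) ->
  (forall j, (j <= n)%N -> PB j -> PA j \/ exists2 i, (i <= d)%N & j = w i) ->
  (forall i, (i <= d)%N -> [/\ (w i <= n)%N, PB (w i) & ~~ PA (w i)]) ->
  (forall i j, (i <= d)%N -> (j <= d)%N -> w i = w j -> i = j) ->
  (forall s i, (i <= d)%N -> c s i != 0) ->
  let phi s u : 'cV[C]_d.+1 := \col_i (cf s u (n - w i) (w i) 0 / c s i) in
  (forall u s, A u ->
     [/\ phi s (X u) = bX W *m phi s u, phi s (Y u) = bY W *m phi s u
       & phi s (Z u) = bZ W *m phi s u]) ->
  quot_iso_dbl X Y Z A B W.
Proof.
move=> hA hB hPB hw inj hc phi hphi.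
exists (fun u => (phi true u, phi false u)); split; [|split; [|split; [|split; [|split]]]].
- move=> x u v _ _.
  have h s : phi s (x *: u + v) = x *: phi s u + phi s v.
    apply/colP => i; rewrite !mxE !cfE.
    by case: (s); rewrite /= mcoeffD mcoeffZ mulrDl mulrA.
  by rewrite !h.
- move=> [v1 v2].
  pose v s := if s then v1 else v2.
  (* Initial data of a preimage: coordinate i, with its normalisation undone, sits at the exponent
     [w i], and every other exponent gets 0. *)
  pose f s j := \sum_(i < d.+1) (w i == j)%:R * (v s i 0 * c s i).
  have [u hu hf] := ck_extension f.
  have hwi (i : 'I_d.+1) : (i <= d)%N by rewrite -ltnS.
  exists u.
    apply/hA; split=> // s j hj hPA; rewrite hf // /f big1 // => i _.
    case: eqP => [e|]; last by rewrite mul0r.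
    by have [_ _] := hw i (hwi i); rewrite e hPA.
  have h s : phi s u = v s.
    apply/colP => i; rewrite mxE hf; last by have [] := hw i (hwi i).
    rewrite /f (bigD1 i) //= eqxx mul1r big1 ?addr0 ?mulfK ?hc // => i' /eqP hi.
    by case: eqP => [/inj e|]; rewrite ?mul0r //; case: hi; apply: val_inj; apply: e.
  by rewrite !h.
- move=> u hu; rewrite (hB u hu); have /hA[hM hPA] := hu; split.
    move=> /pair_equal_spec [e1 e2] s j hj hP.
    have [/hPA -> //|[i hi ->]] := hPB j hj hP.
    have e : phi s u = 0 by case: (s).
    have := congr1 (fun M : 'cV_d.+1 => M (inord i) 0) e; rewrite !mxE inordK ?ltnS //.
    by move=> /eqP; rewrite mulf_eq0 invr_eq0 (negbTE (hc _ _ hi)) orbF => /eqP.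
  move=> h.
  have e s : phi s u = 0.
    apply/colP => i; have [h1 h2 _] := hw i (ltn_ord i).
    by rewrite !mxE h // mul0r.
  by rewrite !e.
- by move=> u hu; have [-> _ _] := hphi u true hu; have [-> _ _] := hphi u false hu.
- by move=> u hu; have [_ -> _] := hphi u true hu; have [_ -> _] := hphi u false hu.
- by move=> u hu; have [_ _ ->] := hphi u true hu; have [_ _ ->] := hphi u false hu.
Qed.

End CauchyKovalevskaya.

(** * Bidiagonal form of the subquotients *)

Section Bidiagonal.
Variable R : realType.
Local Notation C := (complex R).
Implicit Types (a b kap : C) (phi l r v vL vU vZ w : nat -> C).

Lemma signC i : (-1) ^+ i = (if odd i then -1 else 1) :> C.
Proof. by rewrite -signr_odd; case: odd. Qed.

Lemma Xmat_col a d v :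
  Xmat a d *m \col_i v i =
  \col_(i < d.+1) (theta a d i * v i + (if (0 < i)%N then v i.-1 else 0)).
Proof.
apply/colP => i; rewrite !mxE (bigD1 i) //= !mxE eqxx; congr (_ + _).
case: ifP => hi; last first.
  rewrite big1 // => j hj; rewrite !mxE eq_sym (negbTE hj).
  by case: eqP => [e|]; rewrite ?mul0r //; rewrite e in hi.
have hi' : (i.-1 < d.+1)%N by have := ltn_ord i; lia.
rewrite (bigD1 (Ordinal hi')) /=; last by apply/eqP => /(congr1 val) /=; lia.
rewrite big1 ?addr0 => [|j /andP[h1 h2]]; rewrite !mxE.
  by rewrite -val_eqE /= prednK // eqxx; case: eqP => [|_]; [lia | rewrite mul1r].
rewrite eq_sym (negbTE h1); case: eqP => [e|]; rewrite ?mul0r //.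
by case/eqP: h2; apply: val_inj; rewrite /= e.
Qed.

Lemma Ymat_col b d phi v :
  Ymat b d phi *m \col_i v i =
  \col_(i < d.+1) (theta b d i * v i + (if (i < d)%N then phi i.+1 * v i.+1 else 0)).
Proof.
apply/colP => i; rewrite !mxE (bigD1 i) //= !mxE eqxx; congr (_ + _).
case: ifP => hi; last first.
  rewrite big1 // => j hj; rewrite !mxE eq_sym (negbTE hj).
  case: eqP => [e|]; rewrite ?mul0r //.
  by have := ltn_ord j; rewrite e ltnS hi.
have hi' : (i.+1 < d.+1)%N by [].
rewrite (bigD1 (Ordinal hi')) /=; last by apply/eqP => /(congr1 val) /=; lia.
rewrite big1 ?addr0 => [|j /andP[h1 h2]]; rewrite !mxE.
  by rewrite -val_eqE /= eqxx; case: eqP => [|_ //]; lia.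
rewrite eq_sym (negbTE h1); case: eqP => [e|]; rewrite ?mul0r //.
by case/eqP: h2; apply: val_inj; rewrite /= e.
Qed.

Definition scaling l i : C := \prod_(1 <= h < i.+1) l h.

Lemma scalingS l i : scaling l i.+1 = scaling l i * l i.+1.
Proof. by rewrite /scaling big_nat_recr. Qed.

Lemma scaling_neq0 l d :
  (forall i, (0 < i <= d)%N -> l i != 0) -> forall i, (i <= d)%N -> scaling l i != 0.
Proof.
move=> hl; elim=> [|i IH] hi; first by rewrite /scaling big_geq // oner_neq0.
by rewrite scalingS mulf_neq0 ?IH ?hl // ltnW.
Qed.

(* Rescaling by the products of the subdiagonal coefficients [l] turns a
   lower bidiagonal L and an upper bidiagonal U into the matrices of E_d, O_d. *)
Lemma bidiag_normal d a b kap phi l r v vL vU vZ :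
  (forall i, (0 < i <= d)%N -> l i != 0) ->
  (forall i, (0 < i <= d)%N -> phi i = l i * r i) ->
  phi 0%N = 0 -> phi d.+1 = 0 ->
  (forall i, (i <= d)%N ->
     vL i = theta a d i * v i + (if (0 < i)%N then l i * v i.-1 else 0)) ->
  (forall i, (i <= d)%N ->
     vU i = theta b d i * v i + (if (i < d)%N then r i.+1 * v i.+1 else 0)) ->
  (forall i, (i <= d)%N ->
     vZ i = (2 * theta a d i * theta b d i + phi i + phi i.+1 - kap) * v i
       + (if (0 < i)%N then (-1) ^+ i * (l i * v i.-1) else 0)
       - (if (i < d)%N then (-1) ^+ i * (r i.+1 * v i.+1) else 0)) ->
  let X := Xmat a d in let Y := Ymat b d phi in
  let N (w : nat -> C) : 'cV[C]_d.+1 := \col_i (w i / scaling l i) in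
  [/\ N vL = X *m N v, N vU = Y *m N v & N vZ = (X *m Y + Y *m X - kap%:M) *m N v].
Proof.
move=> hl hphi phi0 phid hL hU hZ X Y N.
have hc := scaling_neq0 hl.
have eL w i : (i <= d)%N -> theta a d i * (w i / scaling l i)
     + (if (0 < i)%N then w i.-1 / scaling l i.-1 else 0)
   = (theta a d i * w i + (if (0 < i)%N then l i * w i.-1 else 0)) / scaling l i.
  move=> hi; rewrite mulrDl mulrA; congr (_ + _).
  case: i hi => [|i] hi /=; first by rewrite mul0r.
  by rewrite scalingS; field; rewrite hl ?hc //; apply: ltnW.
have eU w i : (i <= d)%N -> theta b d i * (w i / scaling l i)
     + (if (i < d)%N then phi i.+1 * (w i.+1 / scaling l i.+1) else 0)
   = (theta b d i * w i + (if (i < d)%N then r i.+1 * w i.+1 else 0)) / scaling l i.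
  move=> hi; rewrite mulrDl mulrA; congr (_ + _).
  case: ifP => hi'; last by rewrite mul0r.
  by rewrite scalingS hphi //; field; rewrite hl ?hc.
have NL w : X *m N w = N (fun i => theta a d i * w i + (if (0 < i)%N then l i * w i.-1 else 0)).
  rewrite /X /N (Xmat_col a d (fun i => w i / scaling l i)); apply/colP => i.
  by rewrite !mxE eL // -ltnS.
have NU w : Y *m N w = N (fun i => theta b d i * w i + (if (i < d)%N then r i.+1 * w i.+1 else 0)).
  rewrite /Y /N (Ymat_col b d phi (fun i => w i / scaling l i)); apply/colP => i.
  by rewrite !mxE eU // -ltnS.
split.
- by rewrite NL; apply/colP => i; rewrite !mxE hL // -ltnS.
- by rewrite NU; apply/colP => i; rewrite !mxE hU // -ltnS.
rewrite mulmxBl mulmxDl -!mulmxA NL NU NL NU mul_scalar_mx.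
apply/colP => i; rewrite !mxE hZ; last by rewrite -ltnS.
rewrite [kap * _]mulrA -!(mulrDl, mulrBl); congr (_ / _).
(* The off-diagonal entries are sums of neighbouring eigenvalues, and theta_i + theta_(i-1) = (-1)^i
   for either parameter. At i = 0 and i = d the anticommutator lacks the term phi_0, respectively
   phi_(d+1); these are zero by [phi0] and [phid]. *)
have := ltn_ord i; rewrite ltnS; case: (i : nat) => {i} [|i] hi /=.
  case: ifP => hd.
    by rewrite phi0 (hphi 1%N) // /theta !exprS expr0; field.
  have e : d = 0%N by lia.
  by rewrite e in phid *; rewrite phi0 phid; ring.
have hli : l i.+1 * r i.+1 = phi i.+1 by rewrite hphi.
rewrite hi -hli.
case: ifP => hd.
  by rewrite (hphi i.+2) // /theta !exprS !mulrSr; field.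
have e : d = i.+1 by lia.
by rewrite e in phid *; rewrite phid /theta !exprS !mulrSr; field.
Qed.

End Bidiagonal.

Section Brackets.
Variable R : realType.
Local Notation C := (complex R).
Local Notation I := (sqrtm1 R).
Implicit Types (s : bool).

Lemma br_parity (q : C) j : br q j = if odd j then j%:R + 2 * q else j%:R.
Proof. by rewrite brE signC; case: odd; ring. Qed.

(** The bracket is j for even j and j - t for odd j. *)
Lemma br_neq0 (q : C) t j : 2 * q = - t%:R -> (t < j)%N -> br q j != 0.
Proof.
move=> e lt; rewrite br_parity e; case: odd; last by rewrite pnatr_eq0; lia.
by rewrite -natrB ?pnatr_eq0; lia.
Qed.

Lemma br_eq0 (q : C) t : 2 * q = - t%:R -> odd t -> br q t = 0.
Proof. by move=> e h; rewrite br_parity h e subrr. Qed.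

Lemma sg_neq0 s : sg R s != 0.
Proof. by case: s; rewrite /sg ?oppr_eq0 oner_neq0. Qed.

Lemma coef_neq0 s i (x : C) : x != 0 -> I * sg R s * (-1) ^+ i * x != 0.
Proof. by move=> hx; rewrite !mulf_neq0 ?sqrtm1_neq0 ?sg_neq0 ?signr_eq0. Qed.

End Brackets.

(** * The action of X, Y, Z on the three windows of exponents *)

Section Windows.
Variable R : realType.
Local Notation C := (complex R).
Local Notation I := (sqrtm1 R).
Variables k1 k2 k3 : R.
Local Notation q1 := (toC k1).
Local Notation q2 := (toC k2).
Local Notation q3 := (toC k3).
Variables n t1 t2 : nat.
Hypothesis T1 : 2 * q1 = - t1%:R.
Hypothesis T2 : 2 * q2 = - t2%:R.
Hypothesis odd1 : odd t1.
Hypothesis odd2 : odd t2.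
Hypothesis oddn : odd n.
Hypothesis le12 : (t1 + t2 <= n)%N.
Implicit Types (u : Sp R) (s : bool).
Local Notation M := (Mn k1 k2 k3 n).
Local Notation X := (Xop k1 k2 k3).
Local Notation Y := (Yop k1 k2 k3).
Local Notation Z := (Zop k1 k2 k3).
Local Notation K := (q1 + q2 + q3).
Local Notation nC := (n%:R : C).
Local Notation N := ((nC + 1) / 2).

(* Below-diagonal coefficients of the operator that becomes lower bidiagonal on each
   window: -Y for W_1, Y for W_2, X for W_3. *)
Definition subdiag2 s i : C := I * sg R s * (-1) ^+ i * br q2 (n - i).+1.
Definition subdiag3 s i : C := - I * sg R s * (-1) ^+ i * br q1 (n - i).+1.
Definition subdiag1 s i : C := I * sg R s * (-1) ^+ i * br q2 (n - t1 - i).+1.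

Lemma t1_gt0 : (0 < t1)%N. Proof. by case: t1 odd1. Qed.
Lemma t2_gt0 : (0 < t2)%N. Proof. by case: t2 odd2. Qed.

Lemma signnB i : (i <= n)%N -> (-1) ^+ (n - i) = - (-1) ^+ i :> C.
Proof. by move=> h; rewrite !signC oddB // oddn; case: odd => //=; ring. Qed.

(** The window is i < t_2, where i is the exponent of x_2. At its upper end Y and Z read the
    coefficient at exponent t_2 with the factor [br q2 t2] = 0, so the window closes for every u in
    M_n. *)
Lemma window_W3 u s : M u ->
  let W := Omod t2.-1 q3 (- K - nC - 1) q1 in
  let phi v : 'cV[C]_t2.-1.+1 := \col_i (cf s v (n - i) i 0 / scaling (subdiag3 s) i) in
  [/\ phi (X u) = bX W *m phi u, phi (Y u) = bY W *m phi u & phi (Z u) = bZ W *m phi u].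
Proof.
move=> /Mn_monogenic hm W phi.
have t2p := t2_gt0; have t1p := t1_gt0.
have I2 := sqrtm1_sqr R.
(* Eliminating t_2 in favour of q2 turns the comparison of matrix entries into identities in q1, q2,
   q3, n and i. *)
have dE : (t2.-1)%:R = - 2 * q2 - 1 :> C.
  by rewrite -subn1 natrB // mulNr T2 opprK.
have sg2 : sg R s * sg R s = 1 by case: (s); rewrite /sg; ring.
apply: (@bidiag_normal R _ _ _ _ _ (subdiag3 s)
  (fun i => I * sg R s * (-1) ^+ i * br q2 i)
  (fun i => cf s u (n - i) i 0) (fun i => cf s (X u) (n - i) i 0)
  (fun i => cf s (Y u) (n - i) i 0) (fun i => cf s (Z u) (n - i) i 0)).
- move=> i hi; rewrite /subdiag3 !mulNr oppr_eq0 coef_neq0 //.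
  by apply: br_neq0 T1 _; lia.
- move=> i hi; have h : (i <= n)%N by lia.
  rewrite /phiO /subdiag3 !brE exprS signnB // -(natr1 (n - i)%N) natrB // dE !signC.
  by case: odd; rewrite /=; field: I2 sg2.
- by rewrite /phiO /=; ring.
- by rewrite /phiO prednK // odd2 /= dE -[t2%:R]opprK -T2; ring.
- move=> i hi; have h : (i <= n)%N by lia.
  rewrite cf_Xop // /subdiag3 /theta dE; congr (_ * _ + _); first by field.
  by case: i h {hi} => //= i h; rewrite subnSK.
- move=> i hi; have h : (i <= n)%N by lia.
  rewrite cf_Yop // /theta dE signnB // natrB //; congr (_ * _ + _); first by field.
  case: ifP => hn; last by lia.
  case: ifP => hd.
    by rewrite (_ : (n - i).-1 = n - i.+1)%N; [rewrite exprS; ring | lia].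
  have e : i.+1 = t2 by lia.
  by rewrite e (br_eq0 T2 odd2) mulr0 mul0r.
- move=> i hi; have h : (i <= n)%N by lia.
  rewrite cf_Zop subnK // [(-1) ^+ n]signC oddn; congr (_ * _ + _ - _).
  - rewrite /theta /phiO dE signnB // !signC /=.
    by case: odd; rewrite /=; field.
  - by case: i h {hi} => //= i h; rewrite /subdiag3 subnSK // !exprS; ring: (signM R i).
  case: ifP => hn; last by lia.
  case: ifP => hd.
    by rewrite (_ : (n - i).-1 = n - i.+1)%N; [rewrite exprS; ring: (signM R i) | lia].
  have e : i.+1 = t2 by lia.
  by rewrite e (br_eq0 T2 odd2) mulr0 mul0r.
Qed.

(** Mirror image of [window_W3]: with i the exponent of x_1, Y becomes the lower bidiagonal
    operator, whence the twist (1 2), and the window closes by [br q1 t1] = 0. *)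
Lemma window_W2 u s : M u ->
  let W := tw12 (Omod t1.-1 q3 (- K - nC - 1) q2) in
  let phi v : 'cV[C]_t1.-1.+1 := \col_i (cf s v i (n - i) 0 / scaling (subdiag2 s) i) in
  [/\ phi (X u) = bX W *m phi u, phi (Y u) = bY W *m phi u & phi (Z u) = bZ W *m phi u].
Proof.
move=> /Mn_monogenic hm W phi.
have t2p := t2_gt0; have t1p := t1_gt0.
have I2 := sqrtm1_sqr R.
have dE : (t1.-1)%:R = - 2 * q1 - 1 :> C.
  by rewrite -subn1 natrB // mulNr T1 opprK.
have sg2 : sg R s * sg R s = 1 by case: (s); rewrite /sg; ring.
suff [h1 h2 h3] : [/\ phi (Y u) = bY W *m phi u, phi (X u) = bX W *m phi u
    & phi (Z u) = bZ W *m phi u] by [].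
apply: (@bidiag_normal R _ _ _ _ _ (subdiag2 s)
  (fun i => - I * sg R s * (-1) ^+ i * br q1 i)
  (fun i => cf s u i (n - i) 0) (fun i => cf s (Y u) i (n - i) 0)
  (fun i => cf s (X u) i (n - i) 0) (fun i => cf s (Z u) i (n - i) 0)).
- move=> i hi; rewrite /subdiag2 coef_neq0 //.
  by apply: br_neq0 T2 _; lia.
- move=> i hi; have h : (i <= n)%N by lia.
  rewrite /phiO /subdiag2 !brE exprS signnB // -(natr1 (n - i)%N) natrB // dE !signC.
  by case: odd; rewrite /=; field: I2 sg2.
- by rewrite /phiO /=; ring.
- by rewrite /phiO prednK // odd1 /= dE -[t1%:R]opprK -T1; ring.
- move=> i hi; have h : (i <= n)%N by lia.
  rewrite cf_Yop // /subdiag2 /theta dE; congr (_ * _ + _); first by field.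
  by case: i h {hi} => //= i h; rewrite subnSK.
- move=> i hi; have h : (i <= n)%N by lia.
  rewrite cf_Xop // /theta dE signnB // natrB //; congr (_ * _ + _); first by field.
  case: ifP => hn; last by lia.
  case: ifP => hd.
    by rewrite (_ : (n - i).-1 = n - i.+1)%N; [rewrite exprS; ring | lia].
  have e : i.+1 = t1 by lia.
  by rewrite e (br_eq0 T1 odd1) mulr0 mul0r.
- move=> i hi; have h : (i <= n)%N by lia.
  rewrite cf_Zop subnKC // [(-1) ^+ n]signC oddn addrAC; congr (_ * _ + _ + _).
  - rewrite /theta /phiO dE signnB // !signC /=.
    by case: odd; rewrite /=; field.
  - case: i h {hi} => [|i] h /=; first by rewrite oppr0.
    by rewrite /subdiag2 subnSK // !exprS; ring: (signM R i).
  case: ifP => hn; last by lia.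
  case: ifP => hd.
    rewrite (_ : (n - i).-1 = n - i.+1)%N; last by lia.
    by rewrite exprS; ring: (signM R i).
  have e : i.+1 = t1 by lia.
  by rewrite e (br_eq0 T1 odd1) mulr0 mul0r oppr0.
Qed.

(** Here i is the exponent of x_1 minus t_1. The brackets at the two ends need not vanish; the
    coefficients read outside the window do, by the assumption on u. As t_1 is odd, (-1)^(t_1+i) =
    -(-1)^i, so that -Y rather than Y has the eigenvalues theta_i; this is the source of the sign
    twist. *)
Lemma window_W1 u s : M u ->
  (forall j, (j <= n)%N -> (n - j < t1)%N || (j < t2)%N -> cf s u (n - j) j 0 = 0) ->
  let W := twmm12 (Emod (n - t1 - t2) (q2 + q3 + N) (- q1 - q3 - N) N) in
  let phi v : 'cV[C]_(n - t1 - t2).+1 :=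
    \col_i (cf s v (t1 + i) (n - t1 - i) 0 / scaling (subdiag1 s) i) in
  [/\ phi (X u) = bX W *m phi u, phi (Y u) = bY W *m phi u & phi (Z u) = bZ W *m phi u].
Proof.
move=> /Mn_monogenic hm h0 W phi.
have t2p := t2_gt0; have t1p := t1_gt0.
have I2 := sqrtm1_sqr R.
set d := (n - t1 - t2)%N in W phi *.
have t1E : t1%:R = - 2 * q1 :> C by rewrite mulNr T1 opprK.
have nE : nC = d%:R - 2 * q1 - 2 * q2.
  by rewrite T1 T2 !opprK /d -!natrD; congr _%:R; lia.
have oddd : odd d by rewrite /d !oddB ?odd1 ?odd2 ?oddn //; lia.
have sg2 : sg R s * sg R s = 1 by case: (s); rewrite /sg; ring.
pose f (v : Sp R) i := cf s v (t1 + i) (n - t1 - i) 0.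
pose psi (g : nat -> C) : 'cV[C]_d.+1 := \col_i (g i / scaling (subdiag1 s) i).
pose XE : 'M[C]_d.+1 := Xmat (q2 + q3 + N) d.
pose YE : 'M[C]_d.+1 := Ymat (- q1 - q3 - N) d (phiE (q2 + q3 + N) (- q1 - q3 - N) N d).
pose kap : C := N ^+ 2 - (q2 + q3 + N) ^+ 2 - (- q1 - q3 - N) ^+ 2 + (d%:R + 1) ^+ 2 / 4.
suff [h1 h2 h3] : [/\ psi (fun i => - f (Y u) i) = XE *m psi (f u),
    psi (fun i => - f (X u) i) = YE *m psi (f u)
  & psi (f (Z u)) = (XE *m YE + YE *m XE - kap%:M) *m psi (f u)].
  have psiN g : psi g = - psi (fun i => - g i).
    by apply/colP => i; rewrite !mxE mulNr opprK.
  split; last exact: h3.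
  - by apply: (etrans (psiN (f (X u)))); rewrite h2 -mulNmx.
  - by apply: (etrans (psiN (f (Y u)))); rewrite h1 -mulNmx.
rewrite /XE /YE /kap /psi /f.
have s1 i : (-1) ^+ (t1 + i) = - (-1) ^+ i :> C by rewrite exprD signC odd1; ring.
have s2 i : (i <= d)%N -> (-1) ^+ (n - t1 - i) = (-1) ^+ i :> C.
  move=> hi; have h : (i <= n - t1)%N by lia.
  by rewrite !signC !oddB ?oddn ?odd1 //; lia.
have nB i : (i <= d)%N -> (n - t1 - i)%:R = nC + 2 * q1 - i%:R.
  by move=> hi; rewrite !natrB ?t1E; [ring | lia..].
have vl i : (i <= d)%N -> (0 < t1 + i)%N by lia.
have vr i : (i <= d)%N -> (0 < n - t1 - i)%N by lia.
apply: (@bidiag_normal R _ _ _ _ _ (subdiag1 s)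
  (fun i => - I * sg R s * (-1) ^+ i * br q1 (t1 + i))
  (fun i => cf s u (t1 + i) (n - t1 - i) 0) (fun i => - cf s (Y u) (t1 + i) (n - t1 - i) 0)
  (fun i => - cf s (X u) (t1 + i) (n - t1 - i) 0) (fun i => cf s (Z u) (t1 + i) (n - t1 - i) 0)).
- move=> i hi; rewrite /subdiag1 coef_neq0 //.
  by apply: br_neq0 T2 _; lia.
- move=> i /andP[_ hi].
  rewrite /phiE /subdiag1 !brE [(-1) ^+ _.+1]exprS s1 s2 // -(natr1 (n - t1 - i)%N) nB // natrD t1E nE !signC.
  by case: odd; rewrite /=; field: I2 sg2.
- by rewrite /phiE /=; ring.
- by rewrite /phiE /= oddd /=; ring.
- move=> i hi; rewrite cf_Yop // vl // opprD -mulNr s1 natrD t1E /subdiag1 /theta nE.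
  congr (_ * _ + _); first by field.
  case: i hi => [|i] hi /=.
    (* At i = 0 the neighbour has x_1-exponent t_1 - 1, where u vanishes by [h0]. *)
    rewrite addn0 subn0 (_ : t1.-1 = n - (n - t1).+1)%N ?h0 ?mulr0 ?oppr0 //; lia.
  by rewrite addnS subnSK; [ring | lia].
- move=> i hi; rewrite cf_Xop // vr // opprD -mulNr s2 // nB // /theta nE.
  congr (_ * _ + _); first by field.
  case: ifP => hd.
    rewrite (_ : (n - t1 - i).-1 = n - t1 - i.+1)%N; last by lia.
    by rewrite addnS exprS; ring.
  rewrite (_ : (t1 + i).+1 = n - (n - t1 - i).-1)%N; last by lia.
  by rewrite h0 ?mulr0 ?oppr0 //; lia.
- move=> i hi; rewrite cf_Zop vl // vr // s1 s2 //.
  rewrite (_ : t1 + i + (n - t1 - i) = n)%N; last by lia.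
  rewrite [(-1) ^+ n]signC oddn addrAC; congr (_ * _ + _ + _).
  - rewrite /theta /phiE /= nE !signC.
    by case: odd; rewrite /=; field.
  - case: i hi => [|i] hi /=.
      rewrite addn0 subn0 (_ : t1.-1 = n - (n - t1).+1)%N ?h0 ?mulr0 ?oppr0 //; lia.
    rewrite /subdiag1 addnS subnSK; last by lia.
    by rewrite !exprS; ring: (signM R i).
  case: ifP => hd.
    rewrite (_ : (n - t1 - i).-1 = n - t1 - i.+1)%N; last by lia.
    by rewrite addnS exprS; ring: (signM R i).
  rewrite (_ : (t1 + i).+1 = n - (n - t1 - i).-1)%N; last by lia.
  by rewrite h0 ?mulr0 ?oppr0 //; lia.
Qed.

End Windows.

(** * The flipped basis *)

Section Flip.
Variable R : realType.
Local Notation C := (complex R).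

(* The relation L^2 U + 2 L U L + U L^2 = 2 kap L + U + mu of the BI algebra,
   read on vectors with L v_i = th_i v_i + v_(i+1) and
   U v_i = ts_i v_i + ph_i v_(i-1), one coefficient at a time. *)
Definition bi_cubic (th ts ph : nat -> C) (kap mu : C) : Prop :=
  [/\ ph 0%N = 0,
      forall i, ts i + 2 * ts i.+1 + ts i.+2 = 0,
      forall i, (th i + th i.+1) * ts i + 2 * (th i * ts i + th i.+1 * ts i.+1)
         + (th i + th i.+1) * ts i.+1 + ph i + 2 * ph i.+1 + ph i.+2 - 2 * kap = 0,
      forall i, 4 * th i ^+ 2 * ts i + ph i * (th i.-1 + 3 * th i)
         + ph i.+1 * (3 * th i + th i.+1) - 2 * kap * th i - ts i - mu = 0
    & forall i, ph i * ((th i + th i.-1) ^+ 2 - 1) = 0].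

Section Cubic.
Variables (m : nat) (L U : 'M[C]_m) (th ts ph : nat -> C) (kap mu : C).
Variable v : nat -> 'cV[C]_m.
Hypothesis num : bi_cubic th ts ph kap mu.
Hypothesis hL : forall i, L *m v i = th i *: v i + v i.+1.

Definition cubic_defect (x : 'cV[C]_m) : 'cV[C]_m :=
  L *m (L *m (U *m x)) + 2 *: (L *m (U *m (L *m x))) + U *m (L *m (L *m x))
  - (2 * kap) *: (L *m x) - U *m x - mu *: x.

(** In the expansion on v_i only U v_(i+2) is unknown; what remains has the expressions of
    [bi_cubic] as coefficients. Where the defect vanishes, this becomes a recursion determining
    U. *)
Lemma cubic_defectE i :
  U *m v i = ts i *: v i + ph i *: v i.-1 ->
  U *m v i.+1 = ts i.+1 *: v i.+1 + ph i.+1 *: v i ->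
  cubic_defect (v i) = U *m v i.+2 - (ts i.+2 *: v i.+2 + ph i.+2 *: v i.+1).
Proof.
case: num => ph0 c2 c1 c0 cm h1 h2.
have c2i := c2 i; have c1i := c1 i; have c0i := c0 i; have cmi := cm i.
have sZ (A : 'M[C]_m) x (w : 'cV[C]_m) : A *m (x *: w) = x *: (A *m w) by rewrite scalemxAr.
rewrite /cubic_defect.
(* For i = 0 the predecessor is a default value, and its terms disappear through [ph0]. *)
case: i h1 h2 c2i c1i c0i cmi => [|i] h1 h2 c2i c1i c0i cmi /=.
  rewrite ph0 in c1i c0i.
  rewrite !(hL, h1, h2, mulmxDr, sZ) ph0.
  move: (U *m v 2%N) (v 0%N) (v 1%N) (v 2%N) => y x0 x1 x2.
  apply/colP => r; rewrite !mxE; apply/eqP; rewrite -subr_eq0; apply/eqP.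
  transitivity ((ts 0%N + 2 * ts 1%N + ts 2%N) * x2 r 0
    + ((th 0%N + th 1%N) * ts 0%N + 2 * (th 0%N * ts 0%N + th 1%N * ts 1%N)
         + (th 0%N + th 1%N) * ts 1%N + 0 + 2 * ph 1%N + ph 2%N - 2 * kap) * x1 r 0
    + (4 * th 0%N ^+ 2 * ts 0%N + 0 * (th 0%N.-1 + 3 * th 0%N)
         + ph 1%N * (3 * th 0%N + th 1%N) - 2 * kap * th 0%N - ts 0%N - mu) * x0 r 0).
    rewrite ?ph0; ring.
  by rewrite c2i c1i c0i; ring.
rewrite !(hL, h1, h2, mulmxDr, sZ).
move: (U *m v i.+3) (v i) (v i.+1) (v i.+2) (v i.+3) => y w x0 x1 x2.
apply/colP => r; rewrite !mxE; apply/eqP; rewrite -subr_eq0; apply/eqP.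
transitivity ((ts i.+1 + 2 * ts i.+2 + ts i.+3) * x2 r 0
  + ((th i.+1 + th i.+2) * ts i.+1 + 2 * (th i.+1 * ts i.+1 + th i.+2 * ts i.+2)
       + (th i.+1 + th i.+2) * ts i.+2 + ph i.+1 + 2 * ph i.+2 + ph i.+3 - 2 * kap) * x1 r 0
  + (4 * th i.+1 ^+ 2 * ts i.+1 + ph i.+1 * (th i + 3 * th i.+1)
       + ph i.+2 * (3 * th i.+1 + th i.+2) - 2 * kap * th i.+1 - ts i.+1 - mu) * x0 r 0
  + ph i.+1 * ((th i.+1 + th i) ^+ 2 - 1) * w r 0).
  ring.
by rewrite c2i c1i c0i cmi; ring.
Qed.

End Cubic.

(** Linearity, so that vanishing of the defect can be tested on basis vectors. *)
Lemma cubic_defect_mx m (L U : 'M[C]_m) kap mu :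
  exists A : 'M[C]_m, forall x, cubic_defect L U kap mu x = A *m x.
Proof.
exists (L *m (L *m U) + 2 *: (L *m (U *m L)) + U *m (L *m L)
  - (2 * kap) *: L - U - mu%:M) => x.
by rewrite /cubic_defect !(mulmxDl, mulNmx) -!scalemxAl -!mulmxA mul_scalar_mx.
Qed.

(** L occurs quadratically or together with kap, so the sign cancels. Hence eps L may replace L; its
    eigenvalues are those of the parameter -a. *)
Lemma cubic_defect_eps m (L U : 'M[C]_m) eps kap mu x : eps * eps = 1 ->
  cubic_defect (eps *: L) U (eps * kap) mu x = cubic_defect L U kap mu x.
Proof.
move=> eps2.
have e1 (A : 'M[C]_m) (y : 'cV[C]_m) : (eps *: A) *m y = eps *: (A *m y) by rewrite scalemxAl.
have e2 (A : 'M[C]_m) y (w : 'cV[C]_m) : A *m (y *: w) = y *: (A *m w) by rewrite scalemxAr.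
rewrite /cubic_defect !(e1, e2, scalerA).
have -> : 2 * (eps * kap) * eps = 2 * kap by ring: eps2.
by rewrite -[2 * eps * eps]mulrA eps2 mulr1 !scale1r.
Qed.

(** Indexed by all naturals and zero beyond d, so that L v_i = th_i v_i + v_(i+1) has no boundary
    case. *)
Definition bvec d i : 'cV[C]_d.+1 := \col_j (j == i :> nat)%:R.

Lemma bvec_gt d i : (d < i)%N -> bvec d i = 0.
Proof.
move=> hi; apply/colP => j; rewrite !mxE; case: eqP => // e.
by have := ltn_ord j; rewrite e ltnNge hi.
Qed.

Lemma mulmx_bvec m d (A : 'M[C]_(m, d.+1)) (j : 'I_d.+1) : A *m bvec d j = col j A.
Proof.
rewrite colE; congr (_ *m _); apply/colP => i.
by rewrite !mxE eqxx andbT.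
Qed.

Lemma eq_mx_bvec m d (A B : 'M[C]_(m, d.+1)) :
  (forall i, (i <= d)%N -> A *m bvec d i = B *m bvec d i) -> A = B.
Proof.
move=> h; apply/matrixP => i j.
have /colP/(_ i) := h j (ltn_ord j).
by rewrite !mulmx_bvec !mxE.
Qed.

Lemma Xmat_bvec a d i : Xmat a d *m bvec d i = theta a d i *: bvec d i + bvec d i.+1.
Proof.
rewrite /bvec (Xmat_col a d (fun j => (j == i)%:R)); apply/colP => j; rewrite !mxE.
congr (_ + _).
  by case: eqP => [->|]; rewrite ?mulr0.
by case: (j : nat).
Qed.

Lemma Ymat_bvec b d ph i : ph 0%N = 0 -> (i <= d)%N ->
  Ymat b d ph *m bvec d i = theta b d i *: bvec d i + ph i *: bvec d i.-1.
Proof.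
move=> ph0 hi.
rewrite /bvec (Ymat_col b d ph (fun j => (j == i)%:R)); apply/colP => j; rewrite !mxE.
congr (_ + _).
  by case: eqP => [->|]; rewrite ?mulr0.
case: i hi => [|i] hi; first by rewrite ph0 mul0r mulr0 if_same.
rewrite eqSS /=; case: eqP => [->|]; last by rewrite !mulr0 if_same.
by rewrite hi.
Qed.

(** * The basis u_i and the matrices of L and U in it *)

Section FlipMatrix.
Variables (d : nat) (a b eps kap mu : C) (ph ph' : nat -> C).
Local Notation th := (theta a d).
Local Notation th' := (theta (- a) d).
Local Notation ts := (theta b d).
Local Notation L := (Xmat a d).
Local Notation U := (Ymat b d ph).
Hypothesis eps2 : eps * eps = 1.
Hypothesis num : bi_cubic th ts ph kap mu.
Hypothesis num' : bi_cubic th' ts ph' (eps * kap) mu.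
Hypothesis phd : ph d.+1 = 0.
Hypothesis rev : forall i, (i <= d)%N -> th' i = eps * th (d - i)%N.
Hypothesis base : ph' 1%N = eps * ph 1%N + (eps * th 0%N - th' 0%N) * (ts 0%N - ts 1%N).

Let ph0 : ph 0%N = 0. Proof. by case: num. Qed.
Let ph'0 : ph' 0%N = 0. Proof. by case: num'. Qed.

Lemma eps_neq0 : eps != 0.
Proof. by apply: contra_eq_neq eps2 => ->; rewrite mul0r eq_sym oner_neq0. Qed.

Lemma U_bvec i : U *m bvec d i = ts i *: bvec d i + ph i *: bvec d i.-1.
Proof.
have [hi|hi] := leqP i d; first exact: Ymat_bvec.
(* At i = d + 1 the vector v_i is zero but v_(i-1) = v_d is not; its coefficient is killed by
   [phd]. *)
rewrite (bvec_gt hi) mulmx0 scaler0 add0r; move: hi; rewrite leq_eqVlt => /orP[/eqP <-|hi].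
  by rewrite phd scale0r.
by rewrite bvec_gt ?scaler0 //; lia.
Qed.

Lemma cubic_defect0 x : cubic_defect L U kap mu x = 0.
Proof.
have [A hA] := cubic_defect_mx L U kap mu.
rewrite hA (_ : A = 0) ?mul0mx //; apply: eq_mx_bvec => i hi.
rewrite mul0mx -hA (cubic_defectE num (Xmat_bvec a d)) ?U_bvec //.
by rewrite subrr.
Qed.

(** As th'_j = eps th_(d-j), this is eps^i (L - th_(d-i+1))...(L - th_d) v_0: the eigenvalues are
    used in reverse order. *)
Fixpoint flipv i : 'cV[C]_d.+1 :=
  if i is j.+1 then eps *: (L *m flipv j) - th' j *: flipv j else bvec d 0.

Lemma L_flipv i : (eps *: L) *m flipv i = th' i *: flipv i + flipv i.+1.
Proof. by rewrite /= -scalemxAl addrC subrK. Qed.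

(** Two-step induction: [base] gives U u_1, and the vanishing defect on u_i gives U u_(i+2) from the
    two values before it. *)
Lemma U_flipv i : U *m flipv i = ts i *: flipv i + ph' i *: flipv i.-1.
Proof.
suff [] : U *m flipv i = ts i *: flipv i + ph' i *: flipv i.-1 /\
  U *m flipv i.+1 = ts i.+1 *: flipv i.+1 + ph' i.+1 *: flipv i by [].
elim: i => [|i [IH1 IH2]].
  split; first by rewrite /= U_bvec ph0 ph'0 !scale0r.
  rewrite /= mulmxBr -!scalemxAr Xmat_bvec mulmxDr -scalemxAr !U_bvec ph0 base /=.
  by apply/colP => r; rewrite !mxE; ring.
split=> //.
have := cubic_defectE num' L_flipv IH1 IH2.
by rewrite cubic_defect_eps // cubic_defect0 => /esym/eqP; rewrite subr_eq0 => /eqP.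
Qed.

(** Both bases are polynomials in L applied to v_0, which allows factors to be commuted. *)
Definition qv i : {poly C} := \prod_(h < i) ('X - (th h)%:P).
Definition qu i : {poly C} := \prod_(h < i) (eps *: 'X - (th' h)%:P).

Lemma qvE i : horner_mx L (qv i) *m bvec d 0 = bvec d i.
Proof.
elim: i => [|i IH]; first by rewrite /qv big_ord0 rmorph1 mul1mx.
rewrite /qv big_ord_recr /= mulrC rmorphM /= -mulmxE -mulmxA IH.
by rewrite rmorphB /= horner_mx_X horner_mx_C mulmxBl Xmat_bvec mul_scalar_mx addrC addKr.
Qed.

Lemma quE i : horner_mx L (qu i) *m bvec d 0 = flipv i.
Proof.
elim: i => [|i IH]; first by rewrite /qu big_ord0 rmorph1 mul1mx.
rewrite /qu big_ord_recr /= mulrC rmorphM /= -mulmxE -mulmxA IH.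
rewrite -mul_polyC rmorphB rmorphM /= horner_mx_X !horner_mx_C -mulmxE.
by rewrite mulmxBl !mul_scalar_mx -scalemxAl.
Qed.

(** Over the full range both products contain every th_h once, in opposite orders. *)
Lemma qu_last : qu d.+1 = eps ^+ d.+1 *: qv d.+1.
Proof.
rewrite /qu /qv (reindex_inj rev_ord_inj) /=.
rewrite (eq_bigr (fun h : 'I_d.+1 => eps%:P * ('X - (th h)%:P))).
  by rewrite big_split /= prodr_const card_ord -polyC_exp mul_polyC.
move=> h _; have hd := ltn_ord h.
rewrite subSS rev; last by lia.
by rewrite subKn // mulrBr mul_polyC polyCM.
Qed.

Lemma flipv_last : flipv d.+1 = 0.
Proof.
by rewrite -quE qu_last -mul_polyC rmorphM /= horner_mx_C -mulmxE -mulmxA qvE bvec_gt // mulmx0.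
Qed.

(* For i > 0 the factor L - th_d of u_i completes q_d(L) to q_(d+1)(L), which kills v_0. *)
Lemma qv_flipv i : (i <= d)%N ->
  horner_mx L (qv d) *m flipv i = if i == 0%N then bvec d d else 0.
Proof.
case: i => [|i] hi /=; first exact: qvE.
rewrite -[_ - _]/(flipv i.+1) -quE mulmxA mulmxE -rmorphM /=.
have -> : qv d * qu i.+1 = (\prod_(h < i) (eps *: 'X - (th' h.+1)%:P)) * eps%:P * qv d.+1.
  rewrite /qu /qv big_ord_recl big_ord_recr /=.
  by rewrite rev // subn0 -mul_polyC polyCM; ring.
by rewrite rmorphM /= -mulmxE -mulmxA qvE bvec_gt // mulmx0.
Qed.

(** Coordinates of u_j in the basis v_i, from which the change of basis is seen to be triangular
    with diagonal eps^j. *)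
Fixpoint flipc j i : C :=
  if j is k.+1 then
    eps * (th i * flipc k i + (if (0 < i)%N then flipc k i.-1 else 0)) - th' k * flipc k i
  else (i == 0%N)%:R.

Lemma flipvE j : flipv j = \col_i flipc j i.
Proof.
elim: j => [|j IH] //=; rewrite IH (Xmat_col a d (flipc j)).
by apply/colP => i; rewrite !mxE.
Qed.

Lemma flipc_gt j i : (j < i)%N -> flipc j i = 0.
Proof.
elim: j i => [|j IH] [|i] //= h.
by rewrite !IH //; [ring | apply: ltnW].
Qed.

Lemma flipc_diag j : flipc j j = eps ^+ j.
Proof. by elim: j => [|j IH] //=; rewrite IH flipc_gt // exprS; ring. Qed.

Definition flip_mx : 'M[C]_d.+1 := \matrix_(i, j) flipc j i.

Lemma flip_mx_unit : flip_mx \in unitmx.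
Proof.
rewrite -unitmx_tr unitmxE det_trig.
  rewrite unitfE; apply/prodf_neq0 => i _.
  by rewrite !mxE flipc_diag expf_neq0 // eps_neq0.
by apply/is_trig_mxP => i j h; rewrite !mxE flipc_gt.
Qed.

Lemma flip_mx_bvec i : (i <= d.+1)%N -> flip_mx *m bvec d i = flipv i.
Proof.
rewrite leq_eqVlt => /orP[/eqP ->|hi]; first by rewrite bvec_gt // mulmx0 flipv_last.
rewrite (mulmx_bvec flip_mx (Ordinal hi)) flipvE.
by apply/colP => r; rewrite !mxE.
Qed.

Lemma flip_mxL : (eps *: L) *m flip_mx = flip_mx *m Xmat (- a) d.
Proof.
apply: eq_mx_bvec => i hi; rewrite -!mulmxA Xmat_bvec mulmxDr -scalemxAr.
by rewrite !flip_mx_bvec ?L_flipv // ltnW.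
Qed.

Lemma flip_mxU : U *m flip_mx = flip_mx *m Ymat b d ph'.
Proof.
apply: eq_mx_bvec => i hi; rewrite -!mulmxA Ymat_bvec // mulmxDr -!scalemxAr.
rewrite !flip_mx_bvec ?U_flipv //; lia.
Qed.

(** * Irreducibility from two bidiagonal bases *)

Section Irreducible.
Hypothesis ph_neq0 : forall i, (0 < i <= d)%N -> ph i != 0.
Hypothesis ph'_neq0 : forall i, (0 < i <= d)%N -> ph' i != 0.
Variable S : 'M[C]_d.+1.
Hypothesis SL : (S *m L^T <= S)%MS.
Hypothesis SU : (S *m U^T <= S)%MS.

Let inS (x : 'cV[C]_d.+1) := (x^T <= S)%MS.

Let inS_mul (A : 'M[C]_d.+1) x : (S *m A^T <= S)%MS -> inS x -> inS (A *m x).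
Proof.
move=> hA hx; rewrite /inS trmx_mul.
exact: submx_trans (submxMr _ hx) hA.
Qed.

Let inSZ c x : inS x -> inS (c *: x).
Proof. by move=> h; rewrite /inS linearZ /= scalemx_sub. Qed.

Let inSB x y : inS x -> inS y -> inS (x - y).
Proof. by move=> h1 h2; rewrite /inS linearB /= addmx_sub // eqmx_opp. Qed.

Let inS_qv i x : inS x -> inS (horner_mx L (qv i) *m x).
Proof.
move=> hx; elim: i => [|i IH]; first by rewrite /qv big_ord0 rmorph1 mul1mx.
rewrite /qv big_ord_recr /= mulrC rmorphM /= -mulmxE -mulmxA.
rewrite rmorphB /= horner_mx_X horner_mx_C mulmxBl mul_scalar_mx.
by apply: inSB; [apply: inS_mul | apply: inSZ].
Qed.

Lemma bidiag_irred : (S == (0 : 'M[C]_d.+1))%MS || row_full S.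
Proof.
have [->|S0] := eqVneq S 0; first by rewrite submx_refl.
apply/orP; right.
have coord x : exists y : nat -> C, x = \sum_(i < d.+1) y i *: flipv i.
  exists (fun i => (invmx flip_mx *m x) (inord i) 0).
  rewrite -{1}[x](mulKVmx flip_mx_unit); apply/colP => r.
  rewrite mxE summxE; apply: eq_bigr => i _.
  by rewrite mxE inord_val flipvE !mxE mulrC.
have flipv0 (y : nat -> C) : \sum_(i < d.+1) y i *: flipv i = 0 -> forall i, (i <= d)%N -> y i = 0.
  move=> e i hi.
  have e' : flip_mx *m (\col_(i < d.+1) y i) = 0.
    rewrite -[RHS]e; apply/colP => r; rewrite mxE summxE.
    by apply: eq_bigr => j _; rewrite flipvE !mxE mulrC.
  have := congr1 (mulmx (invmx flip_mx)) e'; rewrite (mulKmx flip_mx_unit) mulmx0.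
  by move=> /colP/(_ (inord i)); rewrite !mxE inordK.
(* Since phi'_k is nonzero, U lowers by one the least index of a nonzero u-coordinate; iterating
   brings it to 0. *)
have lower k (y : nat -> C) : (k <= d)%N -> inS (\sum_(i < d.+1) y i *: flipv i) ->
    y k != 0 -> (forall i, (i < k)%N -> y i = 0) ->
    exists2 z : nat -> C, inS (\sum_(i < d.+1) z i *: flipv i) & z 0%N != 0.
  elim: k y => [|k IH] y hk hy yk y0; first by exists y.
  pose z i := ts i * y i + (if (i < d)%N then ph' i.+1 * y i.+1 else 0).
  apply: (IH z); first exact: ltnW.
  - have -> : \sum_(i < d.+1) z i *: flipv i = U *m \sum_(i < d.+1) y i *: flipv i.
      rewrite mulmx_sumr (eq_bigr (fun i : 'I_d.+1 => (ts i * y i) *: flipv i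
         + (if (i < d)%N then ph' i.+1 * y i.+1 else 0) *: flipv i)); last first.
        by move=> i _; rewrite scalerDl.
      rewrite [RHS](eq_bigr (fun i : 'I_d.+1 => (ts i * y i) *: flipv i
         + (ph' i * y i) *: flipv i.-1)); last first.
        by move=> i _; rewrite -scalemxAr U_flipv scalerDr !scalerA mulrC [y i * ph' i]mulrC.
      rewrite !big_split /=; congr (_ + _).
      rewrite [LHS]big_ord_recr /= ltnn scale0r addr0 [RHS]big_ord_recl /= ph'0 mul0r scale0r add0r.
      by apply: eq_bigr => i _; rewrite /= ltn_ord.
    exact: inS_mul.
  - by rewrite /z y0 // mulr0 add0r hk mulf_neq0 // ph'_neq0.
  - move=> i hi; rewrite /z (y0 i) ?(y0 i.+1) ?mulr0 ?add0r ?if_same //; lia.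
have [z hz z0] : exists2 z : nat -> C, inS (\sum_(i < d.+1) z i *: flipv i) & z 0%N != 0.
  have /rowV0Pn[r hr r0] := S0.
  have [y hy] := coord r^T.
  have [k hk yk] : exists2 k, (k <= d)%N & y k != 0.
    have [/existsP[k hk]|/existsPn h] := boolP [exists k : 'I_d.+1, y k != 0].
      by exists k; rewrite // -ltnS.
    case/eqP: r0; apply: trmx_inj; rewrite hy big1 ?trmx0 // => i _.
    by have := h i; rewrite negbK => /eqP ->; rewrite scale0r.
  have [k' /andP[hk' yk'] hmin] := ex_minnP (ex_intro (fun k => (k <= d)%N && (y k != 0)) k
    (introT andP (conj hk yk))).
  apply: (lower k' y) => //; first by rewrite -hy /inS trmxK.
  move=> i hi; apply/eqP; apply: contraLR (hi) => yi; rewrite -leqNgt; apply: hmin.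
  by rewrite yi (leq_trans (ltnW hi) hk').
(* The polynomial [qv d] in L kills u_i for i > 0 and sends u_0 to v_d. *)
have vd : inS (bvec d d).
  have e : horner_mx L (qv d) *m \sum_(i < d.+1) z i *: flipv i = z 0%N *: bvec d d.
    rewrite mulmx_sumr big_ord_recl -scalemxAr qv_flipv // [X in _ + X]big1 ?addr0 // => i _.
    by rewrite -scalemxAr qv_flipv ?scaler0 //; apply: ltn_ord.
  have := inSZ (z 0%N)^-1 (inS_qv d hz).
  by rewrite e scalerA mulVf // scale1r.
(* Descent from v_d: U v_(j+1) - ts_(j+1) v_(j+1) = ph_(j+1) v_j, with a nonzero factor. *)
have vi k : (k <= d)%N -> inS (bvec d (d - k)).
  elim: k => [|k IH] hk; first by rewrite subn0.
  have := IH (ltnW hk); rewrite -[(d - k)%N]subnSK //; set j := (d - k.+1)%N => hj.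
  have phj : ph j.+1 != 0 by apply: ph_neq0; rewrite /j; lia.
  have := inSZ (ph j.+1)^-1 (inSB (inS_mul SU hj) (inSZ (ts j.+1) hj)).
  by rewrite U_bvec /= addrC addKr scalerA mulVf // scale1r.
rewrite -sub1mx; apply/row_subP => i.
have := vi (d - i)%N (leq_subr _ _); rewrite subKn -1?ltnS // /inS.
rewrite -[bvec d i]mul1mx mulmx_bvec tr_col trmx1; exact.
Qed.

End Irreducible.
End FlipMatrix.
End Flip.

(** * The modules E_d and O_d *)

Section Modules.
Variable R : realType.
Local Notation C := (complex R).
Implicit Types (a b c : C) (d : nat).

Definition kapE a b c d : C := c ^+ 2 - a ^+ 2 - b ^+ 2 + (d%:R + 1) ^+ 2 / 4.
Definition kapO a b c d : C := 2 * a * b - c * (d%:R + 1).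

(** The arguments kap and mu are the scalars by which {X,Y} - Z and {Z,X} - Y act on E_d(a,b,c).
    Fixing the parity of i makes each identity polynomial. *)
Lemma bi_cubicE a b c d :
  bi_cubic (theta a d) (theta b d) (phiE a b c d) (kapE a b c d)
    (b ^+ 2 - a ^+ 2 - c ^+ 2 + (d%:R + 1) ^+ 2 / 4).
Proof.
split=> [|i|i|i|i]; rewrite /theta /phiE /kapE ?signC /=.
- ring.
- by case: odd; rewrite /=; field.
- by case: odd; rewrite /=; field.
- by case: i => [|i]; rewrite ?signC /=; [field | case: odd; rewrite /=; field].
- by case: i => [|i]; rewrite ?signC /=; [field | case: odd; rewrite /=; field].
Qed.

Lemma bi_cubicO a b c d :
  bi_cubic (theta a d) (theta b d) (phiO a b c d) (kapO a b c d)
    (2 * c * a - b * (d%:R + 1)).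
Proof.
split=> [|i|i|i|i]; rewrite /theta /phiO /kapO ?signC /=.
- ring.
- by case: odd; rewrite /=; field.
- by case: odd; rewrite /=; field.
- by case: i => [|i]; rewrite ?signC /=; [field | case: odd; rewrite /=; field].
- by case: i => [|i]; rewrite ?signC /=; [field | case: odd; rewrite /=; field].
Qed.

Lemma phiE0 a b c d : phiE a b c d 0 = 0.
Proof. by rewrite /phiE /= mul0r. Qed.

Lemma phiO0 a b c d : phiO a b c d 0 = 0.
Proof. by rewrite /phiO /= !mul0r. Qed.

Lemma phiE_last a b c d : odd d -> phiE a b c d d.+1 = 0.
Proof. by move=> h; rewrite /phiE /= h /=; ring. Qed.

Lemma phiO_last a b c d : ~~ odd d -> phiO a b c d d.+1 = 0.
Proof. by move=> h; rewrite /phiO /= h /=; ring. Qed.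

(** This dictates eps: 1 for odd d, -1 for even d. *)
Lemma theta_rev a d i : (i <= d)%N -> theta (- a) d i = - (-1) ^+ d * theta a d (d - i).
Proof.
move=> hi; rewrite /theta natrB // !signC oddB //.
by case: (odd d); case: (odd i); rewrite /=; field.
Qed.

Lemma signN_odd d : odd d -> - (-1) ^+ d = 1 :> C.
Proof. by move=> h; rewrite signC h opprK. Qed.

Lemma signN_even d : ~~ odd d -> - (-1) ^+ d = -1 :> C.
Proof. by move=> h; rewrite signC (negbTE h). Qed.

Section BasicIso.
Variable m : nat.
Implicit Types W : BImod R m.

Definition anticomm W kap := bZ W = bX W *m bY W + bY W *m bX W - kap%:M.

(** Z is determined by X, Y and the common scalar kap. *)
Lemma BIiso_of_XY W1 W2 kap P : anticomm W1 kap -> anticomm W2 kap -> P \in unitmx ->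
  P *m bX W1 = bX W2 *m P -> P *m bY W1 = bY W2 *m P -> BIiso W1 W2.
Proof.
move=> e1 e2 uP hX hY; exists P; split=> //; split=> //; split=> //.
rewrite e1 e2 mulmxBr mulmxDr mulmxBl mulmxDl !mulmxA hX hY -!mulmxA hX hY.
by rewrite mul_mx_scalar mul_scalar_mx.
Qed.

Lemma BIiso_trans W1 W2 W3 : BIiso W1 W2 -> BIiso W2 W3 -> BIiso W1 W3.
Proof.
move=> [P [uP [hX [hY hZ]]]] [Q [uQ [kX [kY kZ]]]].
exists (Q *m P); split; first by rewrite unitmx_mul uQ.
by rewrite -!mulmxA hX hY hZ !mulmxA kX kY kZ.
Qed.

Lemma conj_inv (Q A B : 'M[C]_m) : Q \in unitmx -> A *m Q = Q *m B -> invmx Q *m A = B *m invmx Q.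
Proof.
move=> uQ e; apply: (can_inj (mulmxK uQ)).
by rewrite -mulmxA e mulmxA mulVmx // mul1mx -mulmxA mulVmx // mulmx1.
Qed.

Lemma stable_opp (U A : 'M[C]_m) : (U *m (- A)^T <= U)%MS -> (U *m A^T <= U)%MS.
Proof. by rewrite linearN /= mulmxN eqmx_opp. Qed.

Lemma BIirred_twmm W : BIirred W -> BIirred (twmm W).
Proof.
move=> [m0 h]; split=> // U /= /stable_opp hX /stable_opp hY hZ.
exact: h.
Qed.

Lemma BIirred_tw12 W : BIirred W -> BIirred (tw12 W).
Proof. by move=> [m0 h]; split=> // U /= hX hY hZ; apply: h. Qed.

End BasicIso.

(** The change to the basis u_i with eps = 1; kap is even in a, so Z keeps its form. *)
Lemma E_flip d a b c : odd d -> BIiso (Emod d a b c) (Emod d (- a) b c).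
Proof.
move=> od.
have num := bi_cubicE a b c d.
have num' : bi_cubic (theta (- a) d) (theta b d) (phiE (- a) b c d) (1 * kapE a b c d)
    (b ^+ 2 - a ^+ 2 - c ^+ 2 + (d%:R + 1) ^+ 2 / 4).
  by have := bi_cubicE (- a) b c d; rewrite /kapE sqrrN mul1r.
have rev i : (i <= d)%N -> theta (- a) d i = 1 * theta a d (d - i).
  by move=> hi; rewrite theta_rev // signN_odd.
have base : phiE (- a) b c d 1 = 1 * phiE a b c d 1
    + (1 * theta a d 0 - theta (- a) d 0) * (theta b d 0 - theta b d 1).
  by rewrite /phiE /theta /=; field.
have e1 : 1 * 1 = 1 :> C by rewrite mulr1.
pose Q := flip_mx d a 1.
have uQ : Q \in unitmx by apply: flip_mx_unit e1.
have hL := flip_mxL rev; have hU := flip_mxU e1 num num' (phiE_last a b c od) rev base.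
rewrite scale1r in hL.
apply: (@BIiso_of_XY _ _ _ (kapE a b c d) (invmx Q)).
- by [].
- by rewrite /anticomm /= /kapE sqrrN.
- by rewrite unitmx_inv.
- exact: conj_inv.
- exact: conj_inv.
Qed.

(** The twist by the sign automorphism (-1,1), which appears because eps = -1 for even d. *)
Definition twXZ m (W : BImod R m) : BImod R m := mkBI (- bX W) (bY W) (- bZ W).

Definition tw12_opp m (W : BImod R m) : BImod R m := mkBI (- bY W) (- bX W) (bZ W).

Lemma BIiso_tw12 m (W1 W2 : BImod R m) : BIiso W1 W2 -> BIiso (tw12 W1) (tw12 W2).
Proof. by move=> [P [uP [hX [hY hZ]]]]; exists P. Qed.

Lemma BIiso_twXZ m (W1 W2 : BImod R m) : BIiso W1 W2 -> BIiso (twXZ W1) (twXZ W2).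
Proof.
move=> [P [uP [hX [hY hZ]]]]; exists P; split=> //=.
by rewrite !mulmxN !mulNmx hX hY hZ.
Qed.

Lemma BIiso_tw12_opp m (W1 W2 : BImod R m) : BIiso W1 W2 -> BIiso (tw12_opp W1) (tw12_opp W2).
Proof.
move=> [P [uP [hX [hY hZ]]]]; exists P; split=> //=.
by rewrite !mulmxN !mulNmx hX hY hZ.
Qed.

(** The change to the basis u_i with eps = -1: -X takes the parameter -a, and kap changes sign with
    (a, c), hence so does Z. *)
Lemma O_flip d a b c : ~~ odd d -> BIiso (Omod d a b c) (twXZ (Omod d (- a) b (- c))).
Proof.
move=> ed.
have num := bi_cubicO a b c d.
have num' : bi_cubic (theta (- a) d) (theta b d) (phiO (- a) b (- c) d) (-1 * kapO a b c d)
    (2 * c * a - b * (d%:R + 1)).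
  have := bi_cubicO (- a) b (- c) d; rewrite /kapO.
  congr bi_cubic; ring.
have rev i : (i <= d)%N -> theta (- a) d i = -1 * theta a d (d - i).
  by move=> hi; rewrite theta_rev // signN_even.
have base : phiO (- a) b (- c) d 1 = -1 * phiO a b c d 1
    + (-1 * theta a d 0 - theta (- a) d 0) * (theta b d 0 - theta b d 1).
  by rewrite /phiO /theta /=; field.
have e1 : -1 * -1 = 1 :> C by rewrite mulrNN mulr1.
pose Q := flip_mx d a (-1).
have uQ : Q \in unitmx by apply: flip_mx_unit e1.
have hL := flip_mxL rev; have hU := flip_mxU e1 num num' (phiO_last a b c ed) rev base.
apply: (@BIiso_of_XY _ _ _ (kapO a b c d) (invmx Q)).
- by [].
- rewrite /anticomm /= mulNmx mulmxN.
  have -> : 2 * - a * b - - c * (d%:R + 1) = - kapO a b c d by rewrite /kapO; ring.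
  by rewrite raddfN opprK !opprD.
- by rewrite unitmx_inv.
- apply: conj_inv => //=; rewrite mulmxN -hL scaleN1r mulNmx opprK //.
- exact: conj_inv.
Qed.

(* Reading the bidiagonal basis backwards exchanges the roles of X and Y. *)
Lemma bidiag_reverse d a b eps (ph ps : nat -> C) :
  ph 0%N = 0 -> ps 0%N = 0 -> eps * eps = 1 ->
  (forall i, (i <= d)%N -> theta (- a) d i = eps * theta a d (d - i)) ->
  (forall i, (i <= d)%N -> theta (- b) d i = eps * theta b d (d - i)) ->
  (forall i, (0 < i <= d)%N -> ph i != 0) ->
  (forall i, (0 < i <= d)%N -> ps i = ph (d.+1 - i)%N) ->
  exists2 Q : 'M[C]_d.+1, Q \in unitmx &
    Xmat a d *m Q = Q *m (eps *: Ymat (- a) d ps) /\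
    Ymat b d ph *m Q = Q *m (eps *: Xmat (- b) d).
Proof.
move=> ph0 ps0 eps2 ra rb phn hps.
have eps0 : eps != 0 by apply: contra_eq_neq eps2 => ->; rewrite mul0r eq_sym oner_neq0.
(* Q sends v_i to al_i v_(d-i). U moves v_(d-i) to v_(d-i-1) with factor [ph (d - i)]; al absorbs it
   together with eps, leaving subdiagonal entries 1. *)
pose al := scaling (fun h => eps * ph (d.+1 - h)%N).
have al0 i : (i <= d)%N -> al i != 0.
  by apply: scaling_neq0 => {}i hi; rewrite mulf_neq0 // phn //; lia.
pose Q : 'M[C]_d.+1 := \matrix_(i, j) ((i == (d - j)%N :> nat)%:R * al j).
pose P : 'M[C]_d.+1 := \matrix_(i, j) ((i == (d - j)%N :> nat)%:R / al (d - j)%N).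
have hQ i : (i <= d)%N -> Q *m bvec R d i = al i *: bvec R d (d - i).
  move=> hi; have hi' : (i < d.+1)%N by [].
  by rewrite (mulmx_bvec Q (Ordinal hi')); apply/colP => r; rewrite !mxE /= mulrC.
have hP i : (i <= d)%N -> P *m bvec R d i = (al (d - i)%N)^-1 *: bvec R d (d - i).
  move=> hi; have hi' : (i < d.+1)%N by [].
  by rewrite (mulmx_bvec P (Ordinal hi')); apply/colP => r; rewrite !mxE /= mulrC.
exists Q.
  suff /mulmx1_unit[] : Q *m P = 1%:M by [].
  apply: eq_mx_bvec => i hi; rewrite -mulmxA hP // -scalemxAr hQ ?leq_subr // scalerA.
  by rewrite mulVf ?al0 ?leq_subr // scale1r subKn // mul1mx.
split; apply: eq_mx_bvec => i hi; rewrite -!mulmxA hQ // -scalemxAr.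
  rewrite Xmat_bvec -scalemxAl Ymat_bvec // -!scalemxAr mulmxDr -!scalemxAr hQ //.
  rewrite ra // !scalerDr !scalerA; congr (_ *: _ + _).
    by ring: eps2.
  case: i hi => [|i] hi /=.
    by rewrite subn0 bvec_gt // scaler0 ps0 mulr0 scale0r.
  rewrite hQ ?(ltnW hi) // scalerA subnSK // hps //; congr (_ *: _).
  by rewrite /al scalingS subSS; ring.
rewrite Ymat_bvec ?leq_subr // -scalemxAl Xmat_bvec -!scalemxAr mulmxDr -!scalemxAr hQ //.
rewrite rb // !scalerDr !scalerA; congr (_ *: _ + _).
  by ring: eps2.
have [e|hi'] := eqVneq i d.
  by rewrite e subnn ph0 mulr0 scale0r bvec_gt // mulmx0 scaler0.
have {}hi : (i < d)%N by lia.
rewrite hQ // scalerA -subnS; congr (_ *: _).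
by rewrite /al scalingS subSS; ring: eps2.
Qed.

Lemma E_reverse d a b c : odd d -> (forall i, (0 < i <= d)%N -> phiE a b c d i != 0) ->
  BIiso (Emod d a b c) (tw12 (Emod d (- b) (- a) c)).
Proof.
move=> od hn.
have [Q uQ [hX hY]] : exists2 Q : 'M[C]_d.+1, Q \in unitmx &
    Xmat a d *m Q = Q *m (1 *: Ymat (- a) d (phiE (- b) (- a) c d)) /\
    Ymat b d (phiE a b c d) *m Q = Q *m (1 *: Xmat (- b) d).
  apply: bidiag_reverse; rewrite ?phiE0 ?mulr1 //.
  - by move=> i hi; rewrite theta_rev // signN_odd.
  - by move=> i hi; rewrite theta_rev // signN_odd.
  - move=> i hi; rewrite /phiE oddB /= ?od; last by lia.
    rewrite natrB; last by lia.
    by case: odd; rewrite /=; field.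
rewrite !scale1r in hX hY.
apply: (@BIiso_of_XY _ _ _ (kapE a b c d) (invmx Q)) => //=.
- rewrite /anticomm /= [X in X - _]addrC; congr (_ - _%:M); rewrite /kapE; ring.
- by rewrite unitmx_inv.
- exact: conj_inv.
- exact: conj_inv.
Qed.

Lemma O_reverse d a b c : ~~ odd d -> (forall i, (0 < i <= d)%N -> phiO a b c d i != 0) ->
  BIiso (Omod d a b c) (tw12_opp (Omod d (- b) (- a) c)).
Proof.
move=> ed hn.
have [Q uQ [hX hY]] : exists2 Q : 'M[C]_d.+1, Q \in unitmx &
    Xmat a d *m Q = Q *m (-1 *: Ymat (- a) d (phiO (- b) (- a) c d)) /\
    Ymat b d (phiO a b c d) *m Q = Q *m (-1 *: Xmat (- b) d).
  apply: bidiag_reverse; rewrite ?phiO0 ?mulrNN ?mulr1 //.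
  - by move=> i hi; rewrite theta_rev // signN_even.
  - by move=> i hi; rewrite theta_rev // signN_even.
  - move=> i hi; rewrite /phiO oddB /= ?(negbTE ed); last by lia.
    rewrite natrB; last by lia.
    by case: odd; rewrite /=; field.
rewrite !scaleN1r in hX hY.
apply: (@BIiso_of_XY _ _ _ (kapO a b c d) (invmx Q)) => //=.
- rewrite /anticomm /= !mulmxN !mulNmx !opprK [X in X - _]addrC; congr (_ - _%:M).
  by rewrite /kapO; ring.
- by rewrite unitmx_inv.
- exact: conj_inv.
- exact: conj_inv.
Qed.

(** The flip leads from (a,b,c) to (-a,b,c), and reversal from there to the (1 2)-twist of (-b,a,c);
    twisting both ends gives the claim. *)
Lemma E_twist_iso d a b c : odd d -> (forall i, (0 < i <= d)%N -> phiE (- a) b c d i != 0) ->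
  BIiso (twmm12 (Emod d a b c)) (twmm (Emod d (- b) a c)).
Proof.
move=> od hn.
have [P [uP [hX [hY hZ]]]] := BIiso_trans (E_flip a b c od) (E_reverse od hn).
rewrite opprK /= in hX hY hZ.
exists P; split=> //=; rewrite !mulmxN !mulNmx hX hY.
by split=> //; split.
Qed.

(** Flip, reversal, flip: (a,b,c) to (-a,b,-c) to (-b,a,-c) to (b,a,c). The signs collected on the
    way cancel and only the swap is left. *)
Lemma O_twist_iso d a b c : ~~ odd d -> (forall i, (0 < i <= d)%N -> phiO (- a) b (- c) d i != 0) ->
  BIiso (tw12 (Omod d a b c)) (Omod d b a c).
Proof.
move=> ed hn.
have i1 := O_flip a b c ed; have i2 := O_reverse ed hn.
have i3 := O_flip (- b) (- - a) (- c) ed.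
have := BIiso_tw12 (BIiso_trans i1 (BIiso_twXZ (BIiso_trans i2 (BIiso_tw12_opp i3)))).
by rewrite /tw12 /twXZ /tw12_opp /= !opprK.
Qed.

Lemma E_irred d a b c : odd d ->
  (forall i, (0 < i <= d)%N -> phiE a b c d i != 0) ->
  (forall i, (0 < i <= d)%N -> phiE (- a) b c d i != 0) -> BIirred (Emod d a b c).
Proof.
move=> od h1 h2; split=> // S hX hY _.
apply: (@bidiag_irred R d a b 1 (kapE a b c d) (b ^+ 2 - a ^+ 2 - c ^+ 2 + (d%:R + 1) ^+ 2 / 4)
   (phiE a b c d) (phiE (- a) b c d)) => //.
- by rewrite mulr1.
- exact: bi_cubicE.
- by have := bi_cubicE (- a) b c d; rewrite /kapE sqrrN mul1r.
- exact: phiE_last.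
- by move=> i hi; rewrite theta_rev // signN_odd.
- by rewrite /phiE /theta /=; field.
Qed.

Lemma O_irred d a b c : ~~ odd d ->
  (forall i, (0 < i <= d)%N -> phiO a b c d i != 0) ->
  (forall i, (0 < i <= d)%N -> phiO (- a) b (- c) d i != 0) -> BIirred (Omod d a b c).
Proof.
move=> ed h1 h2; split=> // S hX hY _.
apply: (@bidiag_irred R d a b (-1) (kapO a b c d) (2 * c * a - b * (d%:R + 1))
   (phiO a b c d) (phiO (- a) b (- c) d)) => //.
- by rewrite mulrNN mulr1.
- exact: bi_cubicO.
- have := bi_cubicO (- a) b (- c) d; rewrite /kapO.
  congr bi_cubic; ring.
- exact: phiO_last.
- by move=> i hi; rewrite theta_rev // signN_even.
- by rewrite /phiO /theta /=; field.
Qed.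

End Modules.

(** * Non-vanishing of the coefficients for k_3 >= 0 *)

Section Nonvanishing.
Variable R : realType.
Local Notation C := (complex R).

Lemma toC_two_eq (k : R) (t : nat) : 2 * k = - t%:R -> 2 * toC k = - t%:R :> C.
Proof.
move=> e; have -> : toC k = (k%:C)%C by [].
by rewrite -(rmorph_nat (@real_complex R)) -rmorphM e rmorphN rmorph_nat.
Qed.

Lemma natD_toC_neq0 (k : R) (m : nat) : 0 <= k -> (0 < m)%N -> m%:R + 2 * toC k != 0 :> C.
Proof.
move=> k0 m0; have -> : toC k = (k%:C)%C by [].
rewrite -(rmorph_nat (@real_complex R) m) -(rmorph_nat (@real_complex R) 2) -rmorphM -rmorphD /=.
rewrite fmorph_eq0 gt_eqF // ltr_pwDl ?ltr0n //.
by rewrite mulr_ge0.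
Qed.

(** A zero at an odd c means 2k = -c, so [tspec] would give t = c <= n. *)
Lemma br_gt_neq0 (k : R) (t : option nat) n : tspec k t -> opt_lt n t ->
  forall c, (0 < c <= n)%N -> br (toC k) c != 0.
Proof.
move=> ht hn c hc; rewrite br_parity; case: ifP => oc; last by rewrite pnatr_eq0; lia.
apply/negP => /eqP e; have [_ h] := ht c.
have e2 : 2 * k = - c%:R.
  apply/eqP; rewrite -addr_eq0 addrC; apply/eqP.
  apply: (fmorph_inj (@real_complex R)).
  by rewrite rmorph0 -[RHS]e rmorphD rmorphM !rmorph_nat.
by move: hn; rewrite h //=; lia.
Qed.

Variables (q c b r : C) (t t' n i : nat).
Hypothesis qE : 2 * q = - t%:R.
Hypothesis cE : 2 * c = - t'%:R.

(** With these parameters r cancels, and phi_i is up to sign a product of two positive integers. *)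
Lemma phiO_neq0 : odd t -> (t + t' <= n)%N -> (0 < i <= t.-1)%N ->
  b = - (q + c + r) - n%:R - 1 -> phiO r b c t.-1 i != 0.
Proof.
move=> ot le hi ->.
have dE : (t.-1)%:R = - 2 * q - 1 :> C by rewrite -subn1 natrB ?mulNr ?qE ?opprK //; lia.
have -> : phiO r (- (q + c + r) - n%:R - 1) c t.-1 i =
    if odd i then - (t - i)%:R * (n.+1 - i - t')%:R else i%:R * (n.+1 - i)%:R.
  rewrite !natrB; [|lia..]; rewrite -[t%:R]opprK -qE -[t'%:R]opprK -cE /phiO dE.
  by case: odd; rewrite /=; field.
by case: odd; rewrite mulf_neq0 ?oppr_eq0 ?pnatr_eq0 //; lia.
Qed.

(** In the flipped basis one factor is m + 2r with m > 0; for r = k_3 this is where k_3 >= 0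
    enters. *)
Lemma phiO_flip_neq0 : odd t -> (t + t' <= n)%N -> (0 < i <= t.-1)%N ->
  b = - (q + c + r) - n%:R - 1 -> (forall m, (0 < m)%N -> m%:R + 2 * r != 0) ->
  phiO (- r) b (- c) t.-1 i != 0.
Proof.
move=> ot le hi -> nz.
have dE : (t.-1)%:R = - 2 * q - 1 :> C by rewrite -subn1 natrB ?mulNr ?qE ?opprK //; lia.
have -> : phiO (- r) (- (q + c + r) - n%:R - 1) (- c) t.-1 i =
    if odd i then - (t - i)%:R * ((n.+1 - i)%:R + 2 * r)
    else i%:R * ((n.+1 - i - t')%:R + 2 * r).
  rewrite !natrB; [|lia..]; rewrite -[t%:R]opprK -qE -[t'%:R]opprK -cE /phiO dE.
  by case: odd; rewrite /=; field.
by case: odd; rewrite mulf_neq0 ?oppr_eq0 ?pnatr_eq0 ?nz //; lia.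
Qed.

Lemma phiE_neq0 : (t + t' <= n)%N -> (0 < i <= n - t - t')%N ->
  phiE (c + r + (n%:R + 1) / 2) (- q - r - (n%:R + 1) / 2) ((n%:R + 1) / 2) (n - t - t') i != 0.
Proof.
move=> le hi.
have -> : phiE (c + r + (n%:R + 1) / 2) (- q - r - (n%:R + 1) / 2) ((n%:R + 1) / 2) (n - t - t') i =
    if odd i then (t + i)%:R * (n.+1 - t - i)%:R else i%:R * (n.+1 - t - t' - i)%:R.
  rewrite /phiE natrD !natrB; [|lia..]; rewrite -[t%:R]opprK -qE -[t'%:R]opprK -cE.
  by case: odd; rewrite /=; field.
by case: odd; rewrite mulf_neq0 ?pnatr_eq0 //; lia.
Qed.

Lemma phiE_flip_neq0 : (t + t' <= n)%N -> (0 < i <= n - t - t')%N ->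
  (forall m, (0 < m)%N -> m%:R + 2 * r != 0) ->
  phiE (- (c + r + (n%:R + 1) / 2)) (- q - r - (n%:R + 1) / 2) ((n%:R + 1) / 2) (n - t - t') i != 0.
Proof.
move=> le hi nz.
have -> : phiE (- (c + r + (n%:R + 1) / 2)) (- q - r - (n%:R + 1) / 2) ((n%:R + 1) / 2) (n - t - t') i =
    if odd i then - ((n.+1 - t - t' - i)%:R + 2 * r) * ((n.+1 - t - t' - i + n.+1)%:R + 2 * r)
    else i%:R * (n.+1 - t - t' - i)%:R.
  rewrite /phiE natrD !natrB; [|lia..]; rewrite -[t%:R]opprK -qE -[t'%:R]opprK -cE.
  by case: odd; rewrite /=; field.
by case: odd; rewrite mulf_neq0 ?oppr_eq0 ?pnatr_eq0 ?nz //; lia.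
Qed.

End Nonvanishing.

(** * The subquotients of M_n *)

Unset Implicit Arguments.

Theorem theorem8p6 (R : realType) (k1 k2 k3 : R)
    (t1 t2 : nat) (t3 : option nat) (n : nat) :
  tspec k1 (Some t1) -> tspec k2 (Some t2) -> tspec k3 t3 ->
  odd n -> (t1 + t2 <= n)%N -> opt_lt n t3 ->
  let K : complex R := toC k1 + toC k2 + toC k3 in
  let N : complex R := (n%:R + 1) / 2 in
  let nC : complex R := n%:R in
  let X := Xop k1 k2 k3 in let Y := Yop k1 k2 k3 in let Z := Zop k1 k2 k3 in
  let M := Mn k1 k2 k3 n in
  let M1 := Mnx k1 k2 k3 n i1 (Some t1) in
  let M2 := Mnx k1 k2 k3 n i2 (Some t2) in
  let M12 := fun u => M1 u /\ M2 u in
  let W1 := twmm12 (Emod (n - t1 - t2) (toC k2 + toC k3 + N)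
                                       (- toC k1 - toC k3 - N) N) in
  let W2 := tw12 (Omod t1.-1 (toC k3) (- K - nC - 1) (toC k2)) in
  let W3 := Omod t2.-1 (toC k3) (- K - nC - 1) (toC k1) in
  [/\ quot_iso_dbl X Y Z M12 (fun u => u = 0) W1,
      quot_iso_dbl X Y Z M2 M12 W2 /\ quot_iso_dbl X Y Z M M1 W2,
      quot_iso_dbl X Y Z M1 M12 W3 /\ quot_iso_dbl X Y Z M M2 W3 &
      (0 <= k3 ->
       [/\ BIirred W1, BIirred W2, BIirred W3,
           BIiso W1 (twmm (Emod (n - t1 - t2) (toC k1 + toC k3 + N)
                                             (toC k2 + toC k3 + N) N)) &
           BIiso W2 (Omod t1.-1 (- K - nC - 1) (toC k3) (toC k2))])].
Proof.
move=> ts1 ts2 ts3 oddn le12 lt3 K N nC X Y Z M M1 M2 M12 W1 W2 W3.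
have [/(_ erefl)[odd1 e1] _] := ts1 t1.
have [/(_ erefl)[odd2 e2] _] := ts2 t2.
have T1 := toC_two_eq e1; have T2 := toC_two_eq e2.
have b3 := br_gt_neq0 ts3 lt3.
have t1p : (0 < t1)%N by case: (t1) odd1.
have t2p : (0 < t2)%N by case: (t2) odd2.
have b1 := br_eq0 T1 odd1; have b2 := br_eq0 T2 odd2.
have M1P u := @Mnx1P R k1 k2 k3 n b3 t1 u b1.
have M2P u := @Mnx2P R k1 k2 k3 n b3 t2 u b2.
pose P1 : pred nat := fun j => (n - j < t1)%N.
pose P2 : pred nat := fun j => (j < t2)%N.
pose Van (P : pred nat) (u : Sp R) := forall s j, (j <= n)%N -> P j -> cf s u (n - j) j 0 = 0.
have AM u : M u <-> M u /\ Van pred0 u by split=> [|[]].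
have A1 u : M1 u <-> M u /\ Van P1 u := M1P u.
have A2 u : M2 u <-> M u /\ Van P2 u := M2P u.
have A12 u : M12 u <-> M u /\ Van (predU P1 P2) u.
  split=> [[/A1[hM h1] /A2[_ h2]]|[hM h]].
    by split=> // s j hj /orP[]; [apply: h1 | apply: h2].
  by split; [apply/A1 | apply/A2]; split=> // s j hj hP; apply: h => //=; rewrite hP ?orbT.
have c1 s i : (i <= n - t1 - t2)%N -> scaling (subdiag1 k2 n t1 s) i != 0.
  apply: scaling_neq0 => {}i hi; apply: coef_neq0; apply: br_neq0 T2 _; lia.
have c2 s i : (i <= t1.-1)%N -> scaling (subdiag2 k2 n s) i != 0.
  apply: scaling_neq0 => {}i hi; apply: coef_neq0; apply: br_neq0 T2 _; lia.
have c3 s i : (i <= t2.-1)%N -> scaling (subdiag3 k1 n s) i != 0.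
  apply: scaling_neq0 => {}i hi; rewrite /subdiag3 !mulNr oppr_eq0; apply: coef_neq0.
  apply: br_neq0 T1 _; lia.
(* One argument for both quotients in (ii): the exponents surviving in A / B are exactly those in
   [P1]. They are enumerated as n - i, so that i is the exponent of x_1. *)
have Q2 (A B : Sp R -> Prop) (PA PB : pred nat) :
    (forall u, A u <-> M u /\ Van PA u) -> (forall u, A u -> (B u <-> Van PB u)) ->
    (forall j, PB j = PA j || P1 j) -> (forall j, P1 j -> ~~ PA j) ->
    quot_iso_dbl X Y Z A B W2.
  move=> hA hB hPB hPA.
  apply: (@quot_window R k1 k2 k3 n b3 X Y Z A B PA PB _ (fun i => (n - i)%N)
    (fun s => scaling (subdiag2 k2 n s)) W2 hA hB) => //.
  - move=> j hj; rewrite hPB => /orP[|]; first by left.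
    by move=> hP; right; exists (n - j)%N; rewrite /P1 in hP; lia.
  - move=> i hi; have hP : P1 (n - i)%N by rewrite /P1; lia.
    by rewrite hPB hP orbT hPA //; split=> //; lia.
  - by move=> i j hi hj; lia.
  move=> u s /hA[hM _].
  have [h1 h2 h3] := window_W2 T1 T2 odd1 odd2 oddn le12 s hM.
  have e v : \col_(i < t1.-1.+1) (cf s v (n - (n - i)) (n - i) 0 / scaling (subdiag2 k2 n s) i)
    = \col_i (cf s v i (n - i) 0 / scaling (subdiag2 k2 n s) i).
    by apply/colP => i; rewrite !mxE subKn //; have := ltn_ord i; lia.
  by split; apply: (etrans (e _)); [apply: (etrans h1) | apply: (etrans h2) | apply: (etrans h3)];
      congr (_ *m _); apply: esym; apply: e.
(* Likewise for (iii), where the exponents in [P2] survive. *)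
have Q3 (A B : Sp R -> Prop) (PA PB : pred nat) :
    (forall u, A u <-> M u /\ Van PA u) -> (forall u, A u -> (B u <-> Van PB u)) ->
    (forall j, PB j = PA j || P2 j) -> (forall j, P2 j -> ~~ PA j) ->
    quot_iso_dbl X Y Z A B W3.
  move=> hA hB hPB hPA.
  apply: (@quot_window R k1 k2 k3 n b3 X Y Z A B PA PB _ id
    (fun s => scaling (subdiag3 k1 n s)) W3 hA hB) => //.
  - move=> j hj; rewrite hPB => /orP[|]; first by left.
    by move=> hP; right; exists j; rewrite /P2 in hP; lia.
  - move=> i hi; have hP : P2 i by rewrite /P2; lia.
    by rewrite hPB hP orbT hPA //; split=> //; lia.
  move=> u s /hA[hM _].
  have [h1 h2 h3] := window_W3 T1 T2 odd1 odd2 oddn le12 s hM.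
  by split; [apply: h1 | apply: h2 | apply: h3].
(* By t_1 + t_2 <= n the two windows are disjoint; hence passing to M_n(x_2) removes nothing from
   the window [P1], and vice versa. *)
have disj j : P1 j -> ~~ P2 j by rewrite /P1 /P2; lia.
split.
(* The zero submodule is cut out by the vanishing of all coefficients at x_3 = 0, hence [predT]. *)
- apply: (@quot_window R k1 k2 k3 n b3 X Y Z _ _ (predU P1 P2) predT _
    (fun i => (n - t1 - i)%N) (fun s => scaling (subdiag1 k2 n t1 s)) W1 A12) => //.
  + move=> u /A12[hM _]; rewrite (Mn_eq0P b3 hM).
    by split=> h s j hj; [move=> _; apply: h | apply: h].
  + move=> j hj _; have [hP|hP] := boolP (predU P1 P2 j); [by left | right].
    by move: hP; rewrite /= /P1 /P2 => hP; exists (n - t1 - j)%N; lia.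
  + move=> i hi; split=> //; first lia.
    by rewrite /= /P1 /P2; lia.
  + by move=> i j hi hj; lia.
  move=> u s /A12[hM hV].
  have [h1 h2 h3] := window_W1 T1 T2 odd1 odd2 oddn le12 hM (hV s).
  have e v : \col_(i < (n - t1 - t2).+1)
      (cf s v (n - (n - t1 - i)) (n - t1 - i) 0 / scaling (subdiag1 k2 n t1 s) i)
    = \col_i (cf s v (t1 + i) (n - t1 - i) 0 / scaling (subdiag1 k2 n t1 s) i).
    apply/colP => i; rewrite !mxE (_ : n - (n - t1 - i) = t1 + i)%N //.
    by have := ltn_ord i; lia.
  by split; apply: (etrans (e _)); [apply: (etrans h1) | apply: (etrans h2) | apply: (etrans h3)];
      congr (_ *m _); apply: esym; apply: e.
- split.
  + apply: (Q2 _ _ P2 (predU P1 P2)) => // [u /A2[hM h2]|j]; last by rewrite /= orbC.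
    by split=> [/A12[]|h] //; apply/A12.
  + by apply: (Q2 _ _ pred0 P1) => // u hM; split=> [/A1[]|h] //; apply/A1.
- split.
  + apply: (Q3 _ _ P1 (predU P1 P2)) => // [u /A1[hM h1]|j hj].
      by split=> [/A12[]|h] //; apply/A12.
    by apply: contraL hj => /disj.
  + by apply: (Q3 _ _ pred0 P2) => // u hM; split=> [/A2[]|h] //; apply/A2.
move=> k3_ge0.
have nz m := @natD_toC_neq0 R k3 m k3_ge0.
have oddd : odd (n - t1 - t2) by rewrite !oddB ?odd1 ?odd2 ?oddn //; lia.
have ev t : odd t -> ~~ odd t.-1 by case: t.
have le21 : (t2 + t1 <= n)%N by rewrite addnC.
have bE2 : - K - nC - 1 = - (toC k1 + toC k2 + toC k3) - nC - 1 by [].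
have bE3 : - K - nC - 1 = - (toC k2 + toC k1 + toC k3) - nC - 1 by rewrite /K; ring.
split.
- apply/BIirred_tw12/BIirred_twmm/E_irred => // i hi; first exact: (phiE_neq0 _ T1 T2 le12).
  exact: (phiE_flip_neq0 T1 T2 le12).
- apply/BIirred_tw12/O_irred; first exact: ev.
    by move=> i hi; exact: (phiO_neq0 T1 T2 odd1 le12 hi bE2).
  by move=> i hi; exact: (phiO_flip_neq0 T1 T2 odd1 le12 hi bE2 nz).
- apply/O_irred; first exact: ev.
    by move=> i hi; exact: (phiO_neq0 T2 T1 odd2 le21 hi bE3).
  by move=> i hi; exact: (phiO_flip_neq0 T2 T1 odd2 le21 hi bE3 nz).
- have -> : toC k1 + toC k3 + N = - (- toC k1 - toC k3 - N) by rewrite !opprD !opprK.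
  by apply: E_twist_iso => // i hi; exact: (phiE_flip_neq0 T1 T2 le12).
- apply: O_twist_iso; first exact: ev.
  by move=> i hi; exact: (phiO_flip_neq0 T1 T2 odd1 le12 hi bE2 nz).
Qed.
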